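(* Let $M$ be a finite-dimensional Riemannian manifold, $\Omega\subset M$ locally compact, $T>0$, and $F\in C(\chi,\mathbb{R})$. Let $\mathcal{F}$ be a nonempty family of (viscosity) solutions of $u_t+F\le0$ in $(0,T)\times\Omega$. Let $w(t,x)=\sup\{u(t,x):u\in\mathcal{F}\}$ and assume that $w^*(t,x)<\infty$ for all $(t,x)\in(0,T)\times\Omega$. Then $w^*$ is a (viscosity) solution of $u_t+F\le0$ in $(0,T)\times\Omega$.
   Context: Notation. $TM_x$, $TM_x^*$ are the tangent and cotangent spaces at $x$; $\mathcal{L}^2_s(TM_x)$ is the space of symmetric bilinear forms on $TM_x$; $d$ is the Riemannian distance; $d\varphi$, $d^2\varphi$ denote the first derivative and Hessian in the space variable $x$. $$\chi=\{(t,x,r,\zeta,A): t\in[0,T],\ x\in M,\ r\in\mathbb{R},\ \zeta\in TM_x^*,\ A\in\mathcal{L}^2_s(TM_x)\}.$$ Upper semicontinuous envelope. $w^*(t,x)=\lim_{r\downarrow0}\sup\{w(s,y):(s,y)\in(0,T)\times\Omega,\ |s-t|\le r,\ d(y,x)\le r\}$. Parabolic superjet. For $f$ upper semicontinuous on $(0,T)\times\Omega$, $\mathcal{P}^{2,+}f(t,x)$ is the set of triples $(\varphi_t(t,x),d\varphi(t,x),d^2\varphi(t,x))$ where $\varphi\in C^{1,2}([0,T]\times M)$ and $f-\varphi$ attains a local maximum (relative to $(0,T)\times\Omega$) equal to $0$ at $(t,x)$. Solution of $u_t+F\le0$. A real-valued upper semicontinuous function $u$ on $(0,T)\times\Omega$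 is a solution of $u_t+F\le0$ in $(0,T)\times\Omega$ if $p+F(t,x,u(t,x),\zeta,A)\le0$ for all $(t,x)\in(0,T)\times\Omega$ and all $(p,\zeta,A)\in\mathcal{P}^{2,+}u(t,x)$. *)

(* Defs.v *)
From HB Require Import structures.
From mathcomp Require Import all_boot all_order all_algebra.
From mathcomp Require Import all_classical all_reals all_analysis.
Set Implicit Arguments.
Unset Strict Implicit.
Unset Printing Implicit Defensive.
Import Order.TTheory GRing.Theory Num.Theory.
Import numFieldNormedType.Exports.
Local Open Scope classical_set_scope.
Local Open Scope ring_scope.

Section Calculus.
Context {R : realType}.

(* [f] is of class C^k on the open set [U] of a finite-dimensional space. *)
Fixpoint Ck {E W : normedModType R} (k : nat) (U : set E) (f : E -> W) : Prop :=
  if k is k'.+1 then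
    (forall y, U y -> differentiable f y) /\
    (forall v : E, Ck k' U (fun y => 'D_v f y))
  else {within U, continuous f}.

Definition smooth {E W : normedModType R} (U : set E) (f : E -> W) : Prop :=
  forall k, Ck k U f.

(* Derivative of [f] at [t] through points of [D]: one-sided at the endpoints
   when [D] is a closed interval. *)
Definition quotients_within {W : normedModType R} (D : set R) (f : R -> W)
    (t : R) : set_system W :=
  (s - t)^-1 *: (f s - f t) @[s --> within D t^'].

Definition derivable_within {W : normedModType R} (D : set R) (f : R -> W)
    (t : R) : Prop :=
  cvg (quotients_within D f t).

Definition deriv_within {W : normedModType R} (D : set R) (f : R -> W)
    (t : R) : W :=
  lim (quotients_within D f t).

Definition partial {W : normedModType R} {n : nat} (i : 'I_n)
    (f : 'rV[R]_n -> W) (y : 'rV[R]_n) : W :=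
  'D_(delta_mx 0 i) f y.

End Calculus.

(* The library's [locally_compact A] asks for neighbourhoods that are
   relatively compact in the ambient space, which holds for every subset of a
   manifold; here the compact neighbourhoods have to lie in [A]. *)
Definition locally_compact_subset {X : topologicalType} (A : set X) : Prop :=
  forall x, A x ->
    exists K : set X, [/\ compact K, K `<=` A & within A (nbhs x) K].

(* A chart is a homeomorphism from the open set [cdom] onto the open set
   [cran]; the values of [cfun] and [cinv] elsewhere are irrelevant. *)
Record chart (R : realType) (n : nat) (X : topologicalType) := Chart {
  cdom : set X;
  cfun : X -> 'rV[R]_n;
  cinv : 'rV[R]_n -> X;
  cdom_open : open cdom;
  cran_open : open (cfun @` cdom);
  cfunK : forall x, cdom x -> cinv (cfun x) = x;
  cfun_continuous : {within cdom, continuous cfun};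
  cinv_continuous : {within cfun @` cdom, continuous cinv} }.

Definition cran {R : realType} {n : nat} {X : topologicalType}
  (c : chart R n X) : set 'rV[R]_n := cfun c @` cdom c.

Definition overlap {R : realType} {n : nat} {X : topologicalType}
  (c c' : chart R n X) : set 'rV[R]_n := cfun c @` (cdom c `&` cdom c').

Definition transition {R : realType} {n : nat} {X : topologicalType}
  (c c' : chart R n X) : 'rV[R]_n -> 'rV[R]_n := cfun c' \o cinv c.

(* Smooth manifold of dimension [n], with a preferred chart around each point:
   the tangent space at [x] is R^n through the coordinates of [chart_at x]. *)
Record manifold (R : realType) (n : nat) := Manifold {
  manifold_sort :> topologicalType;
  manifold_hausdorff : hausdorff_space manifold_sort;
  manifold_second_countable : @second_countable manifold_sort;
  atlas : set (chart R n manifold_sort);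
  atlas_smooth : forall c c', atlas c -> atlas c' ->
    smooth (overlap c c') (transition c c');
  chart_at : manifold_sort -> chart R n manifold_sort;
  chart_at_atlas : forall x, atlas (chart_at x);
  chart_at_dom : forall x, cdom (chart_at x) x }.

Section TangentSpaces.
Context {R : realType} {n : nat} {M : manifold R n}.

Definition tangent (x : M) : normedModType R := 'rV[R]_n.

(* [z : cotangent x] is the linear form [v |-> v *m z]. *)
Definition cotangent (x : M) : normedModType R := 'cV[R]_n.

(* [A : bilinear_form x] is the form [(v, w) |-> v *m A *m w^T]. *)
Definition bilinear_form (x : M) : normedModType R := 'M[R]_n.

(* A tangent vector at [x] with coordinates [v] in [c] has coordinates
   [v *m jac c c' x] in [c']. *)
Definition jac (c c' : chart R n M) (x : M) : 'M[R]_n :=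
  'J (transition c c') (cfun c x).

(* Elements at [x] given by their components in the chart [c]. *)
Definition cotangent_of (c : chart R n M) (x : M) (z : 'cV[R]_n) :
  cotangent x := jac (chart_at x) c x *m z.

Definition bilinear_form_of (c : chart R n M) (x : M) (A : 'M[R]_n) :
  bilinear_form x := jac (chart_at x) c x *m A *m (jac (chart_at x) c x)^T.

(* Conversely, the components in the chart [c] of a bilinear form at [x]. *)
Definition components_in (c : chart R n M) (x : M) (B : bilinear_form x) :
  'M[R]_n := jac c (chart_at x) x *m B *m (jac c (chart_at x) x)^T.

End TangentSpaces.

Record riemannianManifold (R : realType) (n : nat) := RiemannianManifold {
  riemannian_sort :> manifold R n;
  metric : forall x : riemannian_sort, bilinear_form x;
  metric_sym : forall x, (metric x)^T = metric x;
  metric_posdef : forall (x : riemannian_sort) (v : tangent x),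
    v != 0 -> 0 < (v *m metric x *m v^T) 0 0;
  metric_smooth : forall c, atlas c ->
    smooth (cran c)
      (fun y => components_in c (metric (cinv c y))) }.

Section Riemannian.
Context {R : realType} {n : nat} {M : riemannianManifold R n}.

Definition metric_in (c : chart R n M) (y : 'rV[R]_n) : 'M[R]_n :=
  components_in c (metric (cinv c y)).

(* Gamma^k_ij in the chart [c] *)
Definition christoffel (c : chart R n M) (y : 'rV[R]_n) (k i j : 'I_n) : R :=
  let dg a b l := partial a (fun z => metric_in c z b l) y in
  2^-1 * \sum_(l < n)
    invmx (metric_in c y) k l * (dg i j l + dg j i l - dg l i j).

Definition differential (f : M -> R) (x : M) : cotangent x :=
  let c := chart_at x in
  \col_i partial i (f \o cinv c) (cfun c x).

(* Hessian for the Levi-Civita connection *)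
Definition hessian (f : M -> R) (x : M) : bilinear_form x :=
  let c := chart_at x in
  let fc := f \o cinv c in
  let y := cfun c x in
  \matrix_(i, j) (partial i (partial j fc) y
                  - \sum_(k < n) christoffel c y k i j * partial k fc y).

(* C^1 curve parametrized by [0, 1] *)
Definition C1_arc (gamma : R -> M) : Prop :=
  {within `[0, 1], continuous gamma} /\
  forall c, atlas c ->
    let D := `[0, 1] `&` gamma @^-1` cdom c in
    (forall t, D t -> derivable_within `[0, 1] (cfun c \o gamma) t) /\
    {within D, continuous (deriv_within `[0, 1] (cfun c \o gamma))}.

Definition velocity (gamma : R -> M) (t : R) : tangent (gamma t) :=
  deriv_within `[0, 1] (cfun (chart_at (gamma t)) \o gamma) t.

Definition arc_length (gamma : R -> M) : \bar R :=
  (\int[lebesgue_measure]_(t in `[0%R, 1%R])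
    (Num.sqrt ((velocity gamma t *m metric (gamma t)
                *m (velocity gamma t)^T) 0 0))%:E)%E.

(* [curve_length x y l]: some piecewise C^1 curve, that is a concatenation of
   C^1 arcs, goes from [x] to [y] and has length [l]. *)
Inductive curve_length : M -> M -> \bar R -> Prop :=
| curve_length_nil x : curve_length x x 0%E
| curve_length_cons gamma y l : C1_arc gamma ->
    curve_length (gamma 1) y l ->
    curve_length (gamma 0) y (arc_length gamma + l)%E.

(* Riemannian distance, infinite between distinct connected components *)
Definition rdist (x y : M) : \bar R := ereal_inf [set l | curve_length x y l].

End Riemannian.

Section Viscosity.
Context {R : realType} {n : nat} {M : riemannianManifold R n}.
Variables (T : R) (Omega : set M).

Definition domain : set (R * M) := `]0, T[ `*` Omega.

(* [F] is continuous on the bundle chi over [0, T] x M.  Continuity is read in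
   the trivialization of chi by each chart [c]; the values of [F] off chi
   (time outside [0, T] or non-symmetric form) are irrelevant. *)
Definition chi_in (c : chart R n M) :
    set (R * 'rV[R]_n * R * 'cV[R]_n * 'M[R]_n) :=
  [set q | let: (t, y, r, z, A) := q in
    [/\ `[0, T]%classic t, cran c y & A^T = A]].

Definition continuous_on_chi
    (F : R -> forall x : M, R -> cotangent x -> bilinear_form x -> R) : Prop :=
  forall c, atlas c ->
    {within chi_in c, continuous (fun q =>
      let: (t, y, r, z, A) := q in
      let x := cinv c y in
      F t x r (cotangent_of c x z) (bilinear_form_of c x A))}.

(* The class C^{1,2}([0, T] x M) *)
Definition C12 (phi : R -> M -> R) : Prop :=
  forall c, atlas c ->
    let f t y := phi t (cinv c y) in
    let D := `[0, T] `*` cran c in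
    [/\ {within D, continuous (fun q : R * 'rV[R]_n => f q.1 q.2)},
        (forall t y, D (t, y) ->
          derivable_within `[0, T] (f ^~ y) t) /\
        {within D, continuous (fun q : R * 'rV[R]_n =>
          deriv_within `[0, T] (f ^~ q.2) q.1)},
        forall i : 'I_n,
        (forall t y, D (t, y) -> derivable (f t) y (delta_mx 0 i)) /\
        {within D, continuous (fun q : R * 'rV[R]_n =>
          partial i (f q.1) q.2)}
      & forall i j : 'I_n,
        (forall t y, D (t, y) ->
          derivable (partial j (f t)) y (delta_mx 0 i)) /\
        {within D, continuous (fun q : R * 'rV[R]_n =>
          partial i (partial j (f q.1)) q.2)}].

Definition time_derivative (phi : R -> M -> R) (t : R) (x : M) : R :=
  deriv_within `[0, T] (phi ^~ x) t.

Local Open Scope ereal_scope.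

Definition usc_on_domain (f : R -> M -> \bar R) : Prop :=
  forall t x, domain (t, x) -> forall a : R, f t x < a%:E ->
    \forall q \near within domain (nbhs (t, x)), f q.1 q.2 < a%:E.

Definition usc_envelope (w : R -> M -> \bar R) (t : R) (x : M) : \bar R :=
  lim (ereal_sup [set w q.1 q.2 | q in
         [set q | [/\ domain q, (`|q.1 - t| <= r)%R & rdist q.2 x <= r%:E]]]
       @[r --> (0 : R)^'+]).

Definition superjet (f : R -> M -> \bar R) (t : R) (x : M) :
    set (R * cotangent x * bilinear_form x) :=
  [set (time_derivative phi t x, differential (phi t) x, hessian (phi t) x)
    | phi in [set phi : R -> M -> R |
        [/\ C12 phi, f t x - (phi t x)%:E = 0
          & \forall q \near within domain (nbhs (t, x)),
              f q.1 q.2 - (phi q.1 q.2)%:E <= 0]]].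
Arguments superjet f t x : clear implicits.

(* Viscosity solution of u_t + F <= 0; the first clause says that [u] is
   real-valued on (0, T) x Omega. *)
Definition viscosity_solution
    (F : R -> forall x : M, R -> cotangent x -> bilinear_form x -> R)
    (u : R -> M -> \bar R) : Prop :=
  [/\ forall t x, domain (t, x) -> u t x \is a fin_num,
      usc_on_domain u
    & forall t x, domain (t, x) -> forall p z A,
        superjet u t x (p, z, A) -> (p + F t x (fine (u t x)) z A <= 0)%R].

End Viscosity.

(* Main.v *)
(** Perturb a test function [phi] of the envelope [w^*] at [(t, x)] into
    [phi + (s - t)^2 + eps (h x - h y)], where [h] is a C^2 bump with a strict
    maximum at [x].  On a compact neighbourhood inside [Omega], some [u] of the
    family comes so close to [w^*(t, x)] that the maximum of [u] minus this
    function is attained near [(t, x)], and there [u] is a subsolution.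
    Continuity of [F] then gives the inequality at [(t, x)].  [F] is only
    continuous in a fixed chart, so the Hessian at the nearby points has to be
    expressed in that chart, by the transformation law of the Christoffel
    symbols.  The envelope is defined with the Riemannian distance: straight
    segments of a chart bound it from above, and the bump [h], whose variation
    along a curve is bounded by the length, bounds it from below. *)

Require Import Defs.
From HB Require Import structures.
From mathcomp Require Import all_boot all_order all_algebra.
From mathcomp Require Import all_classical all_reals all_analysis.
From mathcomp Require Import ring lra.
Set Implicit Arguments.
Unset Strict Implicit.
Unset Printing Implicit Defensive.
Import Order.TTheory GRing.Theory Num.Theory.
Import numFieldNormedType.Exports.
Local Open Scope classical_set_scope.
Local Open Scope ring_scope.

(** * Calculus in R^n *)

(** The argument is by contradiction and involves no sequences. If the inequality failed at
    [(t, x)], then by continuity it would fail for all perturbed jets whose parameters (time, chart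
    point, shift of the value, factor of the bump) are within some [d] of the unperturbed ones; one
    perturbation with factor [d / 2] already gives such a jet. The perturbation is there because the
    touching of [w^*] by [phi] need not be strict: the maximum of [u - phi] over the compact set
    could lie on its edge and fail to be local. The two penalties have positive lower bounds away
    from [(t, x)], and [u] is taken within less than these bounds of [w^*(t, x)]. Test functions
    live on all of [M], so the bump is compactly supported; the cube of a positive part is the
    lowest power of it that is C^2. Membership in [C12] is expressed by derivatives in coordinate
    directions, so differentiability, the chain rule and the symmetry of second derivatives are
    derived from continuity of the partials. *)

Lemma near_eq_continuous_at (T U : topologicalType) (f g : T -> U) x :
  (\forall z \near x, f z = g z) -> {for x, continuous f} -> {for x, continuous g}.
Proof.
move=> fg; rewrite /prop_for /continuous_at -(nbhs_singleton fg).
by apply: cvg_trans; exact: near_eq_cvg.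
Qed.

Section MatrixNorm.
Context {R : realType} {m n : nat}.
Implicit Types A : 'M[R]_(m, n).

Lemma ler_entry_norm A i j : `|A i j| <= `|A|.
Proof.
rewrite [leRHS]/Num.Def.normr /= mx_normrE.
exact: (le_bigmax _ (fun ij : 'I_m * 'I_n => `|A ij.1 ij.2|) (i, j)).
Qed.

Lemma ler_norm_entries A (e : R) :
  0 <= e -> (forall i j, `|A i j| <= e) -> `|A| <= e.
Proof.
by move=> e0 Ae; rewrite [leLHS]/Num.Def.normr /= mx_normrE bigmax_le.
Qed.

Lemma ltr_norm_entries A (e : R) :
  0 < e -> (forall i j, `|A i j| < e) -> `|A| < e.
Proof.
by move=> e0 Ae; rewrite [ltLHS]/Num.Def.normr /= mx_normrE bigmax_lt.
Qed.

End MatrixNorm.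

Section MatrixLimits.
Context {R : realType} {T : Type} {F : set_system T} {FF : Filter F}.

Lemma cvg_sum (I : finType) (f : I -> T -> R) (l : I -> R) :
  (forall i, f i x @[x --> F] --> l i) ->
  \sum_i f i x @[x --> F] --> \sum_i l i.
Proof. by move=> fl; apply: cvg_big => // x; exact: add_continuous. Qed.

Lemma cvg_mx m n (f : T -> 'M[R]_(m, n)) (A : 'M[R]_(m, n)) :
  (forall i j, f x i j @[x --> F] --> A i j) -> f x @[x --> F] --> A.
Proof.
move=> fA; apply/cvgrPdist_le => e e0; near=> x.
apply: ler_norm_entries => [|i j]; first exact: ltW.
rewrite !mxE; move: i j; near: x.
apply: filter_forall => i; apply: filter_forall => j.
by have /cvgrPdist_le := fA i j; apply.
Unshelve. all: by end_near.
Qed.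

Lemma cvg_entry m n (f : T -> 'M[R]_(m, n)) (A : 'M[R]_(m, n)) i j :
  f x @[x --> F] --> A -> f x i j @[x --> F] --> A i j.
Proof.
by apply: (@continuous_cvg _ _ _ _ _ _ (fun M : 'M[R]_(m, n) => M i j));
  exact: coord_continuous.
Qed.

Lemma cvg_mulmx m n p (f : T -> 'M[R]_(m, n)) (g : T -> 'M[R]_(n, p))
    (A : 'M[R]_(m, n)) (B : 'M[R]_(n, p)) :
  f x @[x --> F] --> A -> g x @[x --> F] --> B ->
  f x *m g x @[x --> F] --> A *m B.
Proof.
move=> fA gB; apply: cvg_mx => i j; under eq_fun do rewrite mxE; rewrite mxE.
by apply: cvg_sum => k; apply: cvgM; exact: cvg_entry.
Qed.

Lemma cvg_trmx m n (f : T -> 'M[R]_(m, n)) (A : 'M[R]_(m, n)) :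
  f x @[x --> F] --> A -> (f x)^T @[x --> F] --> A^T.
Proof.
move=> fA; apply: cvg_mx => i j; under eq_fun do rewrite mxE; rewrite mxE.
exact: cvg_entry.
Qed.

Lemma cvg_det n (f : T -> 'M[R]_n) (A : 'M[R]_n) :
  f x @[x --> F] --> A -> \det (f x) @[x --> F] --> \det A.
Proof.
move=> fA; apply: cvg_sum => s; apply: cvgM; first exact: cvg_cst.
by apply: cvg_big => [x|i _]; [exact: mul_continuous|exact: cvg_entry].
Qed.

(** Invertibility is the open condition [\det != 0], and on it the inverse is the adjugate divided
    by the determinant, polynomial expressions in the entries. *)
Lemma cvg_invmx n (f : T -> 'M[R]_n) (A : 'M[R]_n) : A \in unitmx ->
  f x @[x --> F] --> A -> invmx (f x) @[x --> F] --> invmx A.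
Proof.
move=> uA fA.
have dA : \det A != 0 by move: uA; rewrite unitmxE unitfE.
have fu : \forall x \near F, f x \in unitmx.
  have dn : nbhs (\det A) [set d : R | d != 0].
    by apply: open_nbhs_nbhs; split => //; exact: open_neq.
  near=> x; rewrite unitmxE unitfE; near: x.
  exact: (cvg_det fA dn).
have adjA : \adj (f x) @[x --> F] --> \adj A.
  apply: cvg_mx => i j; under eq_fun do rewrite mxE; rewrite mxE.
  apply: cvgM; first exact: cvg_cst.
  apply: cvg_det; apply: cvg_mx => k l.
  by under eq_fun do rewrite !mxE; rewrite !mxE; exact: cvg_entry.
rewrite {2}/invmx uA.
have /cvg_trans : invmx (f x) @[x --> F] `=>` (\det (f x))^-1 *: \adj (f x) @[x --> F].
  by apply: near_eq_cvg; near=> x; rewrite /invmx (near fu x).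
apply; apply: cvgZ => //; apply: cvgV => //; exact: cvg_det.
Unshelve. all: by end_near.
Qed.

End MatrixLimits.

(** * Functions with continuous first and second partial derivatives *)

Section PartialDerivatives.
Context {R : realType} {n : nat}.
Implicit Types (V : set 'rV[R]_n) (f g : 'rV[R]_n -> R) (y v : 'rV[R]_n).

(** Only coordinate directions appear because that is the data carried by [C12]; total
    differentiability is recovered in [C1on_differentiable]. *)
Definition C1on V f := forall y, V y ->
  forall i, derivable f y (delta_mx 0 i) /\ {for y, continuous (partial i f)}.

Definition C2on V f := C1on V f /\ forall i, C1on V (partial i f).

Lemma C1on_derivable V f y i :
  C1on V f -> V y -> derivable f y (delta_mx 0 i).
Proof. by move=> fV Vy; have [] := fV y Vy i. Qed.

Lemma C1on_cts_partial V f y i :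
  C1on V f -> V y -> {for y, continuous (partial i f)}.
Proof. by move=> fV Vy; have [] := fV y Vy i. Qed.

Lemma is_derive_translate f y w v (d : R) :
  is_derive (y + w) v f d -> is_derive y v (fun u => f (u + w)) d.
Proof.
by move=> [fd <-]; split;
  rewrite /derivable /derive /=; under eq_fun do rewrite -addrA.
Qed.

Lemma derive_shift_line f y v t :
  derivable f (y + t *: v) v ->
  is_derive t 1 (fun s : R => f (y + s *: v) : R) ('D_v f (y + t *: v)).
Proof.
move=> df; have e : (fun h : R => h^-1 *: ((fun s : R => f (y + s *: v)) (h *: 1 + t) -
     (fun s : R => f (y + s *: v)) t)) =
    (fun h : R => h^-1 *: (f (h *: v + (y + t *: v)) - f (y + t *: v))).
  apply/funext => h /=; congr (_ *: (f _ - _)).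
  by rewrite [h *: 1]mulr1 scalerDl addrCA.
by split; rewrite /derivable /derive /= e.
Qed.

Lemma MVT_line f y v (a : R) :
  (forall s, `|s| <= `|a| -> derivable f (y + s *: v) v) ->
  exists2 c, `|c| <= `|a| & f (y + a *: v) - f y = a * 'D_v f (y + c *: v).
Proof.
move=> df.
pose g := fun s : R => f (y + s *: v).
have dg (s : R) : `|s| <= `|a| -> is_derive s 1 g ('D_v f (y + s *: v)).
  by move=> /df; exact: derive_shift_line.
have cg (b c : R) : (forall s, (s : R) \in `[b, c]%R -> `|s| <= `|a|) ->
    {within `[b, c], continuous g}.
  move=> h; apply: continuous_in_subspaceT => s /set_mem sI.
  have ds := dg _ (h _ sI).
  by apply: differentiable_continuous; apply/derivable1_diffP; case: ds.
have [a0|/ltW a0] := leP 0 a.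
  have h (s : R) : s \in `[0, a]%R -> `|s| <= `|a|.
    by rewrite in_itv /= => /andP[s0 sa]; rewrite !ger0_norm.
  have [|c ca e] := @MVT_segment _ g (fun s => 'D_v f (y + s *: v)) _ _ a0 _ (cg _ _ h).
    by move=> s sa; apply/dg/h; apply: subset_itv_oo_cc.
  exists c; first exact: h.
  by move: e; rewrite /g scale0r addr0 subr0 mulrC.
have h (s : R) : s \in `[a, 0]%R -> `|s| <= `|a|.
  by rewrite in_itv /= => /andP[s0 sa]; rewrite !ler0_norm // lerN2.
have [|c ca e] := @MVT_segment _ g (fun s => 'D_v f (y + s *: v)) _ _ a0 _ (cg _ _ h).
  by move=> s sa; apply/dg/h; apply: subset_itv_oo_cc.
exists c; first exact: h.
move: e; rewrite /g scale0r addr0 sub0r mulrN mulrC => /eqP.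
by rewrite -eqr_oppLR opprB => /eqP.
Qed.

(** The increment from [y] to [y + h] is split into [n] moves along the axes. On each, the mean
    value theorem replaces the difference by a partial at a nearby point, which continuity compares
    with the partial at [y]. *)
Lemma C1on_differentiable V f y :
  open V -> C1on V f -> V y -> differentiable f y.
Proof.
move=> oV fV Vy.
pose dfy (v : 'rV[R]_n) : R := \sum_i v 0 i * partial i f y.
have ldf : linear dfy.
  move=> k u v; rewrite /dfy scaler_sumr -big_split; apply: eq_bigr => i _.
  by rewrite !mxE mulrDl -mulrA.
pose L := GRing.isLinear.Build R 'rV[R]_n R _ dfy ldf.
pose df : {linear 'rV[R]_n -> R} := HB.pack dfy L.
have cdf : continuous df.
  move=> v; apply: (@cvg_sum _ _ (nbhs v)) => i.
  by apply: cvgM; [exact: coord_continuous|exact: cvg_cst].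
(* The premise of [diff_unique] is the first-order expansion with linear part [df]. It is isolated
   as the goal because, once proved, it yields both the differential and differentiability
   itself. *)
have dfE := @diff_unique R _ _ f df y cdf.
lazymatch type of dfE with ?A -> _ => suff H : A end.
  by apply/diff_locallyP; rewrite (dfE H); split.
apply/eqaddoP => e e0.
(* Each of the [n] moves may cost [e / n.+1 * |h|]; the successor keeps the quotient meaningful when
   [n = 0]. *)
have n0 : 0 < (n.+1%:R : R) by rewrite ltr0n.
have cp : \forall z \near y, V z /\ forall i, `|partial i f z - partial i f y| <= e / n.+1%:R.
  near=> z; split; near: z; first exact: open_nbhs_nbhs.
  apply: filter_forall => i; have [_ /cvgrPdistC_le cfi] := fV y Vy i.
  by apply: cfi; exact: divr_gt0.
have /nbhs_ballP[d /= d0 dP] := cp.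
near=> h.
(* [hk k] keeps the first [k] coordinates of [h], so consecutive ones differ by one axis move. *)
pose hk (k : nat) : 'rV[R]_n := \row_j (if (j < k)%N then h 0 j else 0).
have hd : `|h| < d by (near: h; exact: (@nbhs0_lt _ 'rV[R]_n)).
have hk_ball (c : R) (i : 'I_n) : `|c| <= `|h 0 i| ->
    ball y d (y + hk i + c *: delta_mx 0 i).
  move=> ch; rewrite -ball_normE /= -addrA opprD addNKr normrN.
  apply: ltr_norm_entries => // a j; rewrite !mxE ord1 eqxx /=.
  have [->|ji] := eqVneq j i.
    by rewrite ltnn add0r mulr1 (le_lt_trans ch)// (le_lt_trans (ler_entry_norm _ _ _)).
  rewrite mulr0 addr0; case: ifP => _; last by rewrite normr0.
  exact: le_lt_trans (ler_entry_norm _ _ _) hd.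
have hkS (i : 'I_n) : y + hk i.+1 = y + hk i + h 0 i *: delta_mx 0 i.
  rewrite -addrA; congr (_ + _); apply/rowP => j; rewrite !mxE eqxx /= ltnS leq_eqVlt.
  have [->|ji] := eqVneq j i; first by rewrite eqxx ltnn add0r mulr1.
  by rewrite (negbTE (_ : val j != val i)) //= mulr0 addr0.
have step (i : 'I_n) : `|f (y + hk i.+1) - f (y + hk i) - h 0 i * partial i f y|
    <= e / n.+1%:R * `|h|.
  have [|c ch E] := @MVT_line f (y + hk i) (delta_mx 0 i) (h 0 i).
    by move=> s sh; have [Vz _] := dP _ (hk_ball _ _ sh); have [] := fV _ Vz i.
  rewrite hkS E -mulrBr normrM mulrC ler_pM ?ler_entry_norm//.
  by have [_] := dP _ (hk_ball _ _ ch); exact.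
have hk0 : y + hk 0%N = y.
  by rewrite -[RHS]addr0; congr (_ + _); apply/rowP => j; rewrite !mxE.
have hkn : y + hk n = h + y.
  by rewrite addrC; congr (_ + _); apply/rowP => j; rewrite !mxE ltn_ord.
have tel : f (h + y) - f y = \sum_(i < n) (f (y + hk i.+1) - f (y + hk i)).
  by rewrite -hkn -{2}hk0 -(big_mkord xpredT (fun i => f (y + hk i.+1) - f (y + hk i)))
     telescope_sumr.
rewrite [X in `|X|](_ : _ =
    \sum_(i < n) (f (y + hk i.+1) - f (y + hk i) - h 0 i * partial i f y)); last first.
  transitivity (f (h + y) - (f y + dfy h)); first by [].
  by rewrite opprD addrA tel -sumrB.
apply: le_trans (ler_norm_sum _ _ _) _.
apply: le_trans (ler_sum _ (fun i _ => step i)) _.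
rewrite sumr_const card_ord -[leLHS]mulr_natl mulrA ler_wpM2r //.
by rewrite mulrCA ger_pMr // ler_pdivrMr // mul1r ler_nat.
Unshelve. all: by end_near.
Qed.

Lemma C1on_continuous V f y :
  open V -> C1on V f -> V y -> {for y, continuous f}.
Proof.
by move=> oV fV Vy; exact/differentiable_continuous/(C1on_differentiable oV fV).
Qed.

Lemma near_partial V f g y i :
  open V -> V y -> (forall z, V z -> f z = g z) ->
  \forall z \near y, partial i f z = partial i g z.
Proof.
move=> oV Vy fg; have /open_nbhs_nbhs Vn : open_nbhs y V by [].
near=> z; apply: near_eq_derive.
have /open_nbhs_nbhs Vz : open_nbhs z V by split => //; near: z.
by apply: filterS Vz => u /fg.
Unshelve. all: by end_near.
Qed.

Lemma eq_partial V f g y i :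
  open V -> V y -> (forall z, V z -> f z = g z) -> partial i f y = partial i g y.
Proof. by move=> oV Vy /(near_partial i oV Vy)/nbhs_singleton. Qed.

Lemma eq_C1on V f g :
  open V -> (forall z, V z -> f z = g z) -> C1on V f -> C1on V g.
Proof.
move=> oV fg fV y Vy i; have [df cf] := fV y Vy i.
have /open_nbhs_nbhs Vn : open_nbhs y V by [].
split.
  by apply: near_eq_derivable df; apply: filterS Vn => u /fg.
by apply: near_eq_continuous_at cf; exact: (near_partial i oV Vy fg).
Qed.

Lemma eq_C2on V f g :
  open V -> (forall z, V z -> f z = g z) -> C2on V f -> C2on V g.
Proof.
move=> oV fg [fV ffV]; split; first exact: eq_C1on fV.
move=> i; apply: eq_C1on (ffV i) => // z Vz; exact: (eq_partial i oV).
Qed.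

Lemma sub_C1on V V' f : V' `<=` V -> C1on V f -> C1on V' f.
Proof. by move=> sV fV y /sV; exact: fV. Qed.

Lemma sub_C2on V V' f : V' `<=` V -> C2on V f -> C2on V' f.
Proof. by move=> sV [fV ffV]; split=> [|i]; exact: sub_C1on sV _. Qed.

Lemma C1on_local V f :
  (forall y, V y -> exists2 W, W y & C1on W f) -> C1on V f.
Proof. by move=> H y /H[W Wy fW]; exact: fW. Qed.

Lemma C2on_local V f :
  (forall y, V y -> exists2 W, W y & C2on W f) -> C2on V f.
Proof.
move=> H; split=> [|i]; apply: C1on_local => y /H[W Wy [fW ffW]]; exists W => //.
Qed.

(** As [V] is open, the prescribed [df i] agrees with [partial i f] in a whole neighbourhood, so its
    continuity transfers. *)
Lemma C1onP V f (df : 'I_n -> 'rV[R]_n -> R) : open V ->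
  (forall y i, V y -> is_derive y (delta_mx 0 i) f (df i y)) ->
  (forall y i, V y -> {for y, continuous (df i)}) -> C1on V f.
Proof.
move=> oV fdf cdf y Vy i; have [dfy e] := fdf y i Vy; split => //.
apply: near_eq_continuous_at (cdf y i Vy).
have /open_nbhs_nbhs Vn : open_nbhs y V by [].
by apply: filterS Vn => z /(fdf _ i)[].
Qed.

Lemma C1on_is_derive V f y i : C1on V f -> V y ->
  is_derive y (delta_mx 0 i) f (partial i f y).
Proof. by move=> fV Vy; exact/derivableP/C1on_derivable/Vy. Qed.

Lemma C1onD V f g : open V -> C1on V f -> C1on V g -> C1on V (f \+ g).
Proof.
move=> oV fV gV.
apply: (@C1onP V _ (fun i y => partial i f y + partial i g y)) => // y i Vy.
  by apply: is_deriveD; exact: C1on_is_derive Vy.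
by apply: continuousD; exact: C1on_cts_partial Vy.
Qed.

Lemma C1onM V f g : open V -> C1on V f -> C1on V g -> C1on V (f \* g).
Proof.
move=> oV fV gV.
apply: (@C1onP V _ (fun i y => f y * partial i g y + g y * partial i f y)) => // y i Vy.
  by apply: is_deriveM; exact: C1on_is_derive Vy.
by apply: continuousD; apply: continuousM;
  solve [exact: C1on_continuous Vy | exact: C1on_cts_partial Vy].
Qed.

Lemma C1on_cst V (a : R) : C1on V (cst a).
Proof.
move=> y Vy i; split; first exact: derivable_cst.
rewrite (_ : partial i (cst a) = cst 0); first exact: cst_continuous.
by apply/funext => z; exact: derive_cst.
Qed.

Lemma C1on_sum V (I : finType) (f : I -> 'rV[R]_n -> R) : open V ->
  (forall a, C1on V (f a)) -> C1on V (fun y => \sum_a f a y).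
Proof.
move=> oV fV.
suff H (s : seq I) : C1on V (fun y => \sum_(a <- s) f a y) by [].
elim: s => [|a s IH].
  by apply: eq_C1on (C1on_cst 0) => // z _; rewrite big_nil.
by apply: eq_C1on (C1onD oV (fV a) IH) => // z _; rewrite big_cons.
Qed.

Lemma partialD V f g y i : C1on V f -> C1on V g -> V y ->
  partial i (f \+ g) y = partial i f y + partial i g y.
Proof.
by move=> fV gV Vy; apply: deriveD; exact: C1on_derivable Vy.
Qed.

Lemma partialM V f g y i : C1on V f -> C1on V g -> V y ->
  partial i (f \* g) y = f y * partial i g y + g y * partial i f y.
Proof.
by move=> fV gV Vy; apply: deriveM; exact: C1on_derivable Vy.
Qed.

Lemma partial_sum V (I : finType) (f : I -> 'rV[R]_n -> R) y i : open V ->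
  (forall a, C1on V (f a)) -> V y ->
  partial i (fun y => \sum_a f a y) y = \sum_a partial i (f a) y.
Proof.
move=> oV fV Vy.
have H (s : seq I) : is_derive y (delta_mx 0 i) (fun y => \sum_(a <- s) f a y)
    (\sum_(a <- s) partial i (f a) y).
  elim: s => [|a s IH].
    rewrite big_nil (_ : (fun _ => _) = cst 0); first exact: is_derive_cst.
    by apply/funext => z; rewrite big_nil.
  rewrite big_cons (_ : (fun _ => _) = f a \+ (fun y => \sum_(a <- s) f a y)).
    by apply: is_deriveD; exact: C1on_is_derive Vy.
  by apply/funext => z; rewrite big_cons.
by case: (H (index_enum I)).
Qed.

Lemma derive_partial V f y v : open V -> C1on V f -> V y ->
  'D_v f y = \sum_i v 0 i * partial i f y.
Proof.
move=> oV fV Vy; have df := C1on_differentiable oV fV Vy.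
rewrite deriveE // {1}[v]row_sum_delta linear_sum; apply: eq_bigr => i _.
by rewrite linearZ /= -deriveE.
Qed.

(* Both iterated differences of [f] on a small square equal [s^2] times a
   second partial at an intermediate point. *)
Lemma Schwarz V f y i j : open V -> C2on V f -> V y ->
  partial i (partial j f) y = partial j (partial i f) y.
Proof.
move=> oV [fV ffV] Vy.
have Vn : nbhs y V by apply: open_nbhs_nbhs.
pose D k l s : R := f (y + s *: delta_mx 0 k + s *: delta_mx 0 l)
  - f (y + s *: delta_mx 0 k) - f (y + s *: delta_mx 0 l) + f y.
suff H (k l : 'I_n) (e : R) : 0 < e -> \forall s \near (0 : R)^'+,
    `|D k l s - s ^+ 2 * partial l (partial k f) y| <= s ^+ 2 * e.
  apply/eqP; rewrite -subr_eq0 -normr_le0; apply/ler_addgt0Pl => e e0.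
  rewrite addr0; have e2 : 0 < e / 2 by rewrite divr_gt0.
  have [s [[s0 h1] h2]] := filter_ex
    (filterI (filterI (nbhs_right_gt (0 : R)) (H j i _ e2)) (H i j _ e2)).
  have s20 : 0 < s ^+ 2 by rewrite exprn_gt0.
  rewrite -(ler_pM2l s20) -{1}[s ^+ 2]gtr0_norm // -normrM.
  have DC : D i j s = D j i s.
    by rewrite /D (addrAC y); congr (_ + _); exact: addrAC.
  rewrite {}DC in h2; rewrite mulrBr.
  move: (partial i _ y) (partial j _ y) (D j i s) (s ^+ 2) s20 h1 h2 => a b d q _ h1 h2.
  have := ler_normB (d - q * b) (d - q * a).
  have -> : d - q * b - (d - q * a) = q * a - q * b by ring.
  move=> h3; apply: le_trans h3 _; lra.
move=> e0.
have /cvgrPdistC_le /(_ _ e0) cp := @C1on_cts_partial _ _ _ l (ffV k) Vy.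
have /nbhs_ballP[r /= r0 rP] : \forall z \near y, V z /\
    `|partial l (partial k f) z - partial l (partial k f) y| <= e.
  by near=> z; split; near: z.
near=> s; have s0 : 0 < s by near: s; exact: nbhs_right_gt.
have sr : s < r / 2 by near: s; apply: nbhs_right_lt; rewrite divr_gt0.
have yball (c d : R) : `|c| <= s -> `|d| <= s ->
    ball y r (y + c *: delta_mx 0 k + d *: delta_mx 0 l).
  move=> cs ds; rewrite -ball_normE /= -addrA opprD addNKr normrN.
  have dle (q : 'I_n) : `|delta_mx 0 q : 'rV[R]_n| <= 1.
    apply: ler_norm_entries => // a b; rewrite mxE.
    by case: andP => _; rewrite ?normr1 ?normr0.
  apply: le_lt_trans (ler_normD _ _) _; rewrite !normrZ.
  have := ler_pM (normr_ge0 _) (normr_ge0 _) cs (dle k).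
  have := ler_pM (normr_ge0 _) (normr_ge0 _) ds (dle l).
  lra.
have yV (c d : R) (cs : `|c| <= s) (ds : `|d| <= s) := (rP _ (yball c d cs ds)).1.
(* The mean value theorem is applied to the increment [G] along direction [k], then to [partial k f]
   along direction [l]; each application contributes one factor [s]. *)
pose G u := f (u + s *: delta_mx 0 l) - f u.
have sn : `|s| = s by rewrite gtr0_norm.
have dG (c : R) : `|c| <= s -> is_derive (y + c *: delta_mx 0 k) (delta_mx 0 k) G
   (partial k f (y + c *: delta_mx 0 k + s *: delta_mx 0 l)
     - partial k f (y + c *: delta_mx 0 k)).
  move=> cs; apply: is_deriveB; last first.
    apply: (C1on_is_derive _ fV); have := yV c 0 cs; rewrite scale0r addr0; apply.
    by rewrite normr0 ltW.
  apply/is_derive_translate/(C1on_is_derive _ fV).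
  by apply: yV; rewrite ?sn.
have [|c cs E] := @MVT_line G y (delta_mx 0 k) s.
  by move=> c; rewrite sn => /dG[].
rewrite sn in cs.
have [|d ds E'] := @MVT_line (partial k f) (y + c *: delta_mx 0 k) (delta_mx 0 l) s.
  by move=> d; rewrite sn => ds; apply: C1on_derivable (ffV k) _; exact: yV.
rewrite sn in ds.
have := (rP _ (yball c d cs ds)).2.
have -> : D k l s =
    s ^+ 2 * partial l (partial k f) (y + c *: delta_mx 0 k + d *: delta_mx 0 l).
  rewrite expr2 -mulrA -E' -(derive_val (is_derive := dG c cs)) -E /G /D; lra.
rewrite -mulrBr normrM (gtr0_norm (exprn_gt0 _ _)) // => h.
by rewrite ler_wpM2l // exprn_ge0 // ltW.
Unshelve. all: by end_near.
Qed.

End PartialDerivatives.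

Section SmoothMaps.
Context {R : realType} {m n : nat}.
Implicit Types (U : set 'rV[R]_m) (V : set 'rV[R]_n).

Lemma smooth_differentiable (E W : normedModType R) (U : set E) (f : E -> W) y :
  smooth U f -> U y -> differentiable f y.
Proof. by move=> /(_ 1)[df _] /df. Qed.

Lemma derive_compE (E F W : normedModType R) (f : E -> F) (g : F -> W) y v :
  differentiable f y -> differentiable g (f y) ->
  'D_v (g \o f) y = 'D_('D_v f y) g (f y).
Proof.
move=> df dg; have dc : differentiable (g \o f) y by exact: differentiable_comp.
by rewrite (deriveE _ dc) (diff_comp df dg) /= -(deriveE _ df) -(deriveE _ dg).
Qed.

Lemma smooth_derive (E W : normedModType R) (U : set E) (f : E -> W) v :
  smooth U f -> smooth U ('D_v f).
Proof. by move=> sf k; have [_] := sf k.+1; exact. Qed.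

Lemma smooth_continuous (E W : normedModType R) (U : set E) (f : E -> W) y :
  smooth U f -> U y -> {for y, continuous f}.
Proof. by move=> sf Uy; exact/differentiable_continuous/(smooth_differentiable sf). Qed.

Lemma partial_entry p q (f : 'rV[R]_m -> 'M[R]_(p, q)) i a b y :
  differentiable f y -> partial i (fun y => f y a b) y = partial i f y a b.
Proof.
by move=> df; rewrite /partial (derive_mx (diff_derivable df)) mxE.
Qed.

Lemma smooth_C1on p q U (f : 'rV[R]_m -> 'M[R]_(p, q)) a b :
  open U -> smooth U f -> C1on U (fun y => f y a b).
Proof.
move=> oU sf; apply: (@C1onP _ _ U _ (fun i y => partial i f y a b)) => // y i Uy.
  have df := smooth_differentiable sf Uy.
  rewrite -partial_entry //; apply: derivableP.
  by have /derivable_mxP := @diff_derivable _ _ _ _ _ (delta_mx 0 i) df; apply.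
apply: (@continuous_comp _ _ _ (partial i f) (fun A : 'M[R]_(p, q) => A a b)).
  exact: smooth_continuous (smooth_derive _ sf) Uy.
exact: coord_continuous.
Qed.

Lemma smooth_C2on p q U (f : 'rV[R]_m -> 'M[R]_(p, q)) a b :
  open U -> smooth U f -> C2on U (fun y => f y a b).
Proof.
move=> oU sf; split=> [|i]; first exact: smooth_C1on.
apply: eq_C1on (smooth_C1on a b oU (smooth_derive (delta_mx 0 i) sf)) => // z Uz.
by rewrite partial_entry //; exact: smooth_differentiable sf Uz.
Qed.

Section Composition.
Variables (U : set 'rV[R]_m) (V : set 'rV[R]_n) (tau : 'rV[R]_m -> 'rV[R]_n).
Hypotheses (oU : open U) (oV : open V) (stau : smooth U tau).
Hypothesis tauV : forall y, U y -> V (tau y).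
Variable f : 'rV[R]_n -> R.

Lemma derive_comp v y : C1on V f -> U y ->
  'D_v (f \o tau) y = \sum_a ('D_v tau y) 0 a * partial a f (tau y).
Proof.
move=> fV Uy; have dt := smooth_differentiable stau Uy.
have df := C1on_differentiable oV fV (tauV Uy).
rewrite (derive_compE v dt df); exact: derive_partial oV fV (tauV Uy).
Qed.

Lemma partial_comp i y : C1on V f -> U y ->
  partial i (f \o tau) y = \sum_a (partial i tau y) 0 a * partial a f (tau y).
Proof. exact: derive_comp. Qed.

Lemma C1on_comp : C1on V f -> C1on U (f \o tau).
Proof.
move=> fV; apply: (@C1onP _ _ U _ (fun i y =>
  \sum_a (partial i tau y) 0 a * partial a f (tau y))) => // y i Uy.
  rewrite -partial_comp //; apply/derivableP/diff_derivable.
  apply: differentiable_comp; first exact: smooth_differentiable stau Uy.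
  exact: C1on_differentiable oV fV (tauV Uy).
apply: (@cvg_sum _ _ (nbhs y)) => a; apply: cvgM.
  apply: cvg_entry.
  exact: smooth_continuous (smooth_derive (delta_mx 0 i) stau) Uy.
apply: continuous_comp; first exact: smooth_continuous stau Uy.
exact: C1on_cts_partial fV (tauV Uy).
Qed.

End Composition.

Section SecondOrder.
Variables (U : set 'rV[R]_m) (V : set 'rV[R]_n) (tau : 'rV[R]_m -> 'rV[R]_n).
Hypotheses (oU : open U) (oV : open V) (stau : smooth U tau).
Hypothesis tauV : forall y, U y -> V (tau y).
Variable f : 'rV[R]_n -> R.
Hypothesis fV : C2on V f.

Let C1term i a : C1on U ((fun y => (partial i tau y) 0 a) \* (partial a f \o tau)).
Proof.
apply: C1onM => //.
  exact: smooth_C1on 0 a oU (smooth_derive (delta_mx 0 i) stau).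
by apply: C1on_comp oV stau tauV _ _ => //; exact: fV.2.
Qed.

(** The chain rule differentiated once more by the product rule. The summand with second derivatives
    of [tau] is the non-tensorial part, which the Christoffel symbols absorb in [hessian_change]. *)
Lemma partial2_comp i j y : U y ->
  partial i (partial j (f \o tau)) y =
  \sum_a (partial i (partial j tau) y 0 a * partial a f (tau y) +
    partial j tau y 0 a *
      \sum_b partial i tau y 0 b * partial b (partial a f) (tau y)).
Proof.
move=> Uy; have sj := smooth_derive (delta_mx 0 j) stau.
transitivity (partial i (fun y => \sum_a
    ((fun y => (partial j tau y) 0 a) \* (partial a f \o tau)) y) y).
  apply: eq_partial oU Uy _ => z Uz.
  by rewrite (partial_comp oV stau tauV) //; exact: fV.1.
rewrite (partial_sum _ oU) //; apply: eq_bigr => a _.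
rewrite (@partialM _ _ U) //; last 2 first.
  exact: smooth_C1on 0 a oU sj.
  by apply: C1on_comp oV stau tauV _ _ => //; exact: fV.2.
rewrite addrC /= (partial_comp oV stau tauV _ (fV.2 a) Uy) partial_entry; last first.
  exact: smooth_differentiable sj Uy.
by rewrite [_ * _ a]mulrC.
Qed.

Lemma C2on_comp : C2on U (f \o tau).
Proof.
have fV1 := fV.1.
split=> [|i]; first exact: C1on_comp fV1.
apply: eq_C1on (C1on_sum oU (C1term i)) => // z Uz.
by rewrite (partial_comp oV stau tauV).
Qed.

End SecondOrder.
End SmoothMaps.

(** * Charts *)

Section Charts.
Context {R : realType} {n : nat} {X : topologicalType}.
Implicit Types (c : chart R n X) (x : X) (z : 'rV[R]_n).

Lemma open_cran c : open (cran c). Proof. exact: cran_open. Qed.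

Lemma cran_cfun c x : cdom c x -> cran c (cfun c x).
Proof. by exists x. Qed.

Lemma cdom_cinv c z : cran c z -> cdom c (cinv c z).
Proof. by case=> x cx <-; rewrite cfunK. Qed.

Lemma cinvK c z : cran c z -> cfun c (cinv c z) = z.
Proof. by case=> x cx <-; rewrite cfunK. Qed.

Lemma continuous_cfun c x : cdom c x -> {for x, continuous (cfun c)}.
Proof.
have := @cfun_continuous _ _ _ c; rewrite continuous_open_subspace; last exact: cdom_open.
by move=> h cx; apply: h; exact: mem_set.
Qed.

Lemma continuous_cinv c z : cran c z -> {for z, continuous (cinv c)}.
Proof.
have := @cinv_continuous _ _ _ c; rewrite continuous_open_subspace; last exact: cran_open.
by move=> h cx; apply: h; exact: mem_set.
Qed.

Lemma nbhs_cdom c x : cdom c x -> nbhs x (cdom c).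
Proof. by move=> cx; apply: open_nbhs_nbhs; split => //; exact: cdom_open. Qed.

Lemma nbhs_cran c z : cran c z -> nbhs z (cran c).
Proof. by move=> cz; apply: open_nbhs_nbhs; split => //; exact: cran_open. Qed.

(** The description as a preimage under [cinv c] makes openness of the overlap a matter of
    continuity. *)
Lemma overlapE c c' : overlap c c' = cran c `&` cinv c @^-1` cdom c'.
Proof.
apply/seteqP; split => z.
  by move=> [x [cx cx'] <-]; split => /=; [exact: cran_cfun|rewrite cfunK].
move=> [cz cz']; exists (cinv c z); last exact: cinvK.
by split => //; exact: cdom_cinv.
Qed.

Lemma overlap_cfun c c' x : cdom c x -> cdom c' x -> overlap c c' (cfun c x).
Proof. by move=> cx cx'; exists x. Qed.

Lemma open_overlap c c' : open (overlap c c').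
Proof.
rewrite overlapE openE => z [cz cz']; apply: filterI; first exact: nbhs_cran.
exact: (continuous_cinv cz (nbhs_cdom cz')).
Qed.

Lemma transition_overlap c c' z :
  overlap c c' z -> overlap c' c (transition c c' z).
Proof. by case=> x [cx cx'] <-; rewrite /transition /= cfunK //; exists x. Qed.

Lemma overlap_cran c c' z : overlap c c' z -> cran c z.
Proof. by rewrite overlapE => -[]. Qed.

Lemma overlap_cdom c c' z : overlap c c' z -> cdom c' (cinv c z).
Proof. by rewrite overlapE => -[]. Qed.

Lemma transition_cran c c' z : overlap c c' z -> cran c' (transition c c' z).
Proof. by move/transition_overlap/overlap_cran. Qed.

Lemma cinv_transition c c' z :
  overlap c c' z -> cinv c' (transition c c' z) = cinv c z.
Proof. by case=> x [cx cx'] <-; rewrite /transition /= !cfunK. Qed.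

Lemma transition_cfun c c' x : cdom c x ->
  transition c c' (cfun c x) = cfun c' x.
Proof. by move=> cx; rewrite /transition /= cfunK. Qed.

End Charts.

Lemma eq_mulmx_rV (R : realType) p q (A B : 'M[R]_(p, q)) :
  (forall v : 'rV_p, v *m A = v *m B) -> A = B.
Proof. by move=> AB; apply/row_matrixP => i; rewrite !rowE AB. Qed.

Arguments open_cran {R n X} c.
Arguments open_overlap {R n X} c c'.

Section Jacobians.
Context {R : realType} {n : nat} {M : manifold R n}.
Implicit Types (c : chart R n M) (x : M).

Lemma jacE c c' x v : atlas c -> atlas c' -> cdom c x -> cdom c' x ->
  v *m jac c c' x = 'D_v (transition c c') (cfun c x).
Proof.
move=> ac ac' cx cx'; rewrite deriveEjacobian //.
apply: smooth_differentiable (atlas_smooth ac ac') _; exact: overlap_cfun.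
Qed.

Lemma jac_entry c c' x i a : atlas c -> atlas c' -> cdom c x -> cdom c' x ->
  jac c c' x i a = partial i (transition c c') (cfun c x) 0 a.
Proof.
move=> ac ac' cx cx'.
by rewrite /partial -jacE // -rowE [RHS]mxE.
Qed.

(** The chain rule for transition maps, in the row-vector convention where Jacobians act on the
    right. The composition identity holds near the point only, which is enough for derivatives. *)
Lemma jac_comp c1 c2 c3 x : atlas c1 -> atlas c2 -> atlas c3 ->
  cdom c1 x -> cdom c2 x -> cdom c3 x ->
  jac c1 c2 x *m jac c2 c3 x = jac c1 c3 x.
Proof.
move=> a1 a2 a3 x1 x2 x3.
have e12 v := jacE v a1 a2 x1 x2; have e23 v := jacE v a2 a3 x2 x3.
have e13 v := jacE v a1 a3 x1 x3; move: e12 e23 e13.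
move: (jac c1 c2 x) (jac c2 c3 x) (jac c1 c3 x) => A B C eA eB eC.
apply: eq_mulmx_rV => v; rewrite mulmxA eA eB eC {eA eB eC}.
have d12 := smooth_differentiable (atlas_smooth a1 a2) (overlap_cfun x1 x2).
have d23 := smooth_differentiable (atlas_smooth a2 a3) (overlap_cfun x2 x3).
rewrite -(transition_cfun c2 x1) in d23 *.
set z := cfun c1 x in d12 d23 *.
have -> : 'D_v (transition c1 c3) z =
    'D_v (transition c2 c3 \o transition c1 c2) z.
  apply: near_eq_derive.
  have : nbhs (cfun c1 x) (overlap c1 c2).
    by apply: open_nbhs_nbhs; split; [exact: open_overlap|exact: overlap_cfun].
  apply: filterS => w w12; rewrite /= [RHS]/transition /=.
  by rewrite cinv_transition.
by rewrite (derive_compE v d12 d23).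
Qed.

Lemma jac_id c x : atlas c -> cdom c x -> jac c c x = 1%:M.
Proof.
move=> ac cx; apply: eq_mulmx_rV => v; rewrite mulmx1 (jacE _ ac ac cx cx).
rewrite -[RHS](derive_id (cfun c x)); apply: near_eq_derive.
by apply: filterS (nbhs_cran (cran_cfun cx)) => z /cinvK.
Qed.

Lemma jacV c c' x : atlas c -> atlas c' -> cdom c x -> cdom c' x ->
  jac c c' x *m jac c' c x = 1%:M.
Proof. by move=> ac ac' cx cx'; rewrite jac_comp // jac_id. Qed.

Lemma jac_unit c c' x : atlas c -> atlas c' -> cdom c x -> cdom c' x ->
  jac c c' x \in unitmx.
Proof.
move=> ac ac' cx cx'; have := jacV ac ac' cx cx'.
by move: (jac c c' x) (jac c' c x) => A B /mulmx1_unit[].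
Qed.

End Jacobians.

(** * Christoffel symbols and Hessians under a change of charts *)

Lemma posdef_unitmx (R : realType) n (A : 'M[R]_n) :
  (forall v : 'rV_n, v != 0 -> 0 < (v *m A *m v^T) 0 0) -> A \in unitmx.
Proof.
move=> posA; rewrite -row_free_unit -kermx_eq0; apply/negPn/negP => /rowV0Pn[v].
by move/sub_kermxP => vA0 /posA; rewrite vA0 mul0mx mxE ltxx.
Qed.

(* The change of coordinates of Christoffel symbols, contracted with a
   covector [d].  [J] and [P] stand for the first and second derivatives of the
   transition map, [dG] for the derivatives of the metric matrix [G], and [D']
   for the derivatives of [J *m G *m J^T]. *)
Lemma christoffel_change (R : realType) n (J G : 'M[R]_n) (P : 'I_n -> 'I_n -> 'I_n -> R)
    (dG D' : 'I_n -> 'I_n -> 'I_n -> R) (d : 'I_n -> R) :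
  (forall i j a, P i j a = P j i a) ->
  G^T = G -> G \in unitmx -> J \in unitmx ->
  (forall i j l, D' i j l = \sum_a \sum_b (P i j a * G a b * J l b +
     J j a * (\sum_c J i c * dG c a b) * J l b + J j a * G a b * P i l b)) ->
  forall i j,
  \sum_k (2^-1 * \sum_l invmx (J *m G *m J^T) k l * (D' i j l + D' j i l - D' l i j))
     * (\sum_a J k a * d a) =
  \sum_a P i j a * d a + \sum_a \sum_b J i b * J j a *
    \sum_k (2^-1 * \sum_l invmx G k l * (dG b a l + dG a b l - dG l b a)) * d k.
Proof.
move=> Psym Gsym uG uJ D'E i j.
have GsymE a b : G a b = G b a by rewrite -[in LHS]Gsym mxE.
pose p : 'cV[R]_n := \col_a P i j a.
pose s : 'cV[R]_n := \col_b \sum_a \sum_c J i c * J j a *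
  (dG c a b + dG a c b - dG b c a).
pose dv : 'cV[R]_n := \col_a d a.
pose S : 'cV[R]_n := \col_l (D' i j l + D' j i l - D' l i j).
pose T1 i j l := \sum_a \sum_b P i j a * G a b * J l b.
(* [T1] and [E] separate the second derivatives of the transition map from the derivatives of the
   metric. *)
pose E i j l := \sum_a \sum_b J j a * (\sum_c J i c * dG c a b) * J l b.
have D'TE i' j' l : D' i' j' l = T1 i' j' l + T1 i' l j' + E i' j' l.
  rewrite D'E addrAC; under eq_bigr do rewrite !big_split /=.
  rewrite !big_split /=; congr (_ + _ + _).
  rewrite exchange_big; apply: eq_bigr => a _; apply: eq_bigr => b _.
  by rewrite GsymE; ring.
have T1C i' j' l : T1 i' j' l = T1 j' i' l.
  by apply: eq_bigr => a _; apply: eq_bigr => b _; rewrite Psym.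
(* By the symmetry of [P] in its first two indices, the six [T1] terms of the bracket collapse to
   [2 * T1 i j l]. The bracket is thus [J] times a vector, ready to cancel against the inverse
   metric. *)
have SE : S = J *m (2 *: (G *m p) + s).
  apply/colP => l; rewrite mulmxDr -scalemxAr !mxE !D'TE.
  rewrite (T1C j i l) (T1C l i j) (T1C l j i).
  have -> : \sum_a J l a * (G *m p) a 0 = T1 i j l.
    rewrite /T1 exchange_big; apply: eq_bigr => b _.
    rewrite mxE mulr_sumr; apply: eq_bigr => a _.
    by rewrite mxE (GsymE b a); ring.
  have -> : \sum_a J l a * s a 0 = E i j l + E j i l - E l i j.
    rewrite /E -[X in _ - X]/(
      \sum_(c < n) \sum_(a < n) J i c * (\sum_b J l b * dG b c a) * J j a).
    rewrite [X in X + _ - _]exchange_big [X in _ + X - _]exchange_big /=.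
    rewrite [X in _ - X](_ : _ =
        \sum_b \sum_a \sum_c J i c * J l b * dG b c a * J j a); last first.
      rewrite exchange_big [RHS]exchange_big /=; apply: eq_bigr => a _.
      rewrite [RHS]exchange_big /=; apply: eq_bigr => c _.
      by rewrite mulr_sumr mulr_suml; apply: eq_bigr => b _; ring.
    rewrite -big_split -sumrB; apply: eq_bigr => b _ /=.
    rewrite mxE mulr_sumr.
    rewrite [X in _ = _ + X - _](_ : _ =
        \sum_a \sum_c J j a * J i c * dG a c b * J l b); last first.
      rewrite [RHS]exchange_big; apply: eq_bigr => c _ /=.
      by rewrite mulr_sumr mulr_suml; apply: eq_bigr => a _; ring.
    rewrite -big_split -sumrB; apply: eq_bigr => a _ /=.
    rewrite mulr_sumr mulr_sumr mulr_suml -big_split -sumrB /=.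
    by apply: eq_bigr => c _; ring.
  rewrite /GRing.scale /=; ring.
set G' := J *m G *m J^T.
have uJt : J^T \in unitmx by rewrite unitmx_tr.
have uG' : G' \in unitmx by rewrite !unitmx_mul uJ uG uJt.
have G'sym : G'^T = G' by rewrite !trmx_mul trmxK Gsym mulmxA.
have JGJ : J^T *m invmx G' *m J = invmx G.
  apply: (can_inj (mulKmx uG)); rewrite mulmxV //.
  apply: (can_inj (mulKmx uJ)); rewrite mulmx1 !mulmxA -/G'.
  by rewrite mulmxV // mul1mx.
(* In matrix form, the factor [J] of [S] and the factor [J] of the covector enclose [invmx G'], and
   [JGJ] turns the product into [invmx G]. The [p] part then loses its [G] and gives the
   second-derivative term; the [s] part gives the Christoffel symbols of [G]. *)
transitivity (2^-1 * ((invmx G' *m S)^T *m (J *m dv)) 0 0).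
  rewrite mxE mulr_sumr; apply: eq_bigr => k _; rewrite -mulrA; congr (_ * _).
  rewrite !mxE; congr (_ * _); apply: eq_bigr => l _; first by rewrite !mxE.
  by rewrite mxE.
rewrite trmx_mul trmx_inv G'sym SE trmx_mul !mulmxA -(mulmxA _ J^T) -(mulmxA _ _ J) JGJ.
rewrite -mulmxA.
rewrite (_ : (2 *: (G *m p) + s)^T = 2 *: (p^T *m G) + s^T); last first.
  by rewrite raddfD /= linearZ /= trmx_mul Gsym.
rewrite mulmxDl -scalemxAl mulmxA mulmxK // !mxE mulrDr mulrA mulVf ?mul1r //.
congr (_ + _); first by apply: eq_bigr => a _; rewrite !mxE.
have Gisym a b : invmx G a b = invmx G b a.
  by rewrite -[in LHS]Gsym -trmx_inv mxE.
transitivity (\sum_l \sum_k \sum_a \sum_c (2^-1 * invmx G k l *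
   (J i c * J j a * (dG c a l + dG a c l - dG l c a)) * d k)).
  rewrite mulr_sumr; apply: eq_bigr => l _.
  rewrite !mxE !mulr_sumr; apply: eq_bigr => k _.
  rewrite mulr_suml mulr_sumr; apply: eq_bigr => a _.
  rewrite mulr_suml mulr_sumr; apply: eq_bigr => c _.
  by rewrite mxE Gisym; ring.
rewrite exchange_big /=; under eq_bigr do rewrite exchange_big /=.
rewrite exchange_big /=; apply: eq_bigr => a _.
under eq_bigr do rewrite exchange_big /=.
rewrite exchange_big /=; apply: eq_bigr => c _.
rewrite mulr_sumr; apply: eq_bigr => k _.
rewrite mulr_sumr mulr_suml mulr_sumr; apply: eq_bigr => l _; ring.
Qed.

Section ChangeOfCharts.
Context {R : realType} {n : nat} {M : riemannianManifold R n}.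
Implicit Types (c : chart R n M) (x : M) (z : 'rV[R]_n).

Lemma metric_in_sym c z : (metric_in c z)^T = metric_in c z.
Proof.
rewrite /metric_in /components_in; set x := cinv c z; have := Defs.metric_sym x.
by move: (jac _ _ x) (Defs.metric x) => A B Bs; rewrite !trmx_mul trmxK Bs mulmxA.
Qed.

Lemma metric_in_cfun c x : cdom c x ->
  metric_in c (cfun c x) = jac c (chart_at x) x *m Defs.metric x *m (jac c (chart_at x) x)^T.
Proof. by move=> cx; rewrite /metric_in /components_in cfunK. Qed.

Lemma metric_in_chart_at x : metric_in (chart_at x) (cfun (chart_at x) x) = Defs.metric x.
Proof.
have [a d] := (chart_at_atlas x, chart_at_dom x).
rewrite metric_in_cfun //; have := jac_id a d; move: (jac _ _ _) => A ->.
by rewrite trmx1 mulmx1 mul1mx.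
Qed.

Lemma metric_in_change c c' x : atlas c -> atlas c' -> cdom c x -> cdom c' x ->
  metric_in c' (cfun c' x) =
  jac c' c x *m metric_in c (cfun c x) *m (jac c' c x)^T.
Proof.
move=> ac ac' cx cx'; rewrite [LHS](metric_in_cfun cx') (metric_in_cfun cx).
have := jac_comp ac' ac (chart_at_atlas x) cx' cx (chart_at_dom x).
move: (jac c' c x) (jac c _ x) (jac c' _ x) (Defs.metric x) => A B C D <-.
by rewrite trmx_mul !mulmxA.
Qed.

Lemma metric_in_posdef c z (v : 'rV[R]_n) : atlas c -> cran c z ->
  v != 0 -> 0 < (v *m metric_in c z *m v^T) 0 0.
Proof.
move=> ac cz v0; have cx := cdom_cinv cz.
have := jac_unit ac (chart_at_atlas _) cx (chart_at_dom _).
have := @metric_posdef _ _ _ (cinv c z) (v *m jac c (chart_at (cinv c z)) (cinv c z)).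
rewrite /metric_in /components_in.
move: (jac _ _ _) (Defs.metric _) => J g gpos uJ.
rewrite !mulmxA -(mulmxA _ J^T) -trmx_mul; apply: gpos.
by apply: contra_neq v0 => vJ0; rewrite -(mulmxK uJ v) vJ0 mul0mx.
Qed.

Lemma metric_in_unit c z : atlas c -> cran c z -> metric_in c z \in unitmx.
Proof. by move=> ac cz; apply: posdef_unitmx => v; exact: metric_in_posdef. Qed.

Lemma smooth_metric_in c : atlas c -> smooth (cran c) (metric_in c).
Proof. exact: metric_smooth. Qed.

(** The product rule applied to [J G J^T] on the overlap, arranged as the hypothesis on [D'] in
    [christoffel_change]. *)
Lemma partial_metric_change c c' x i j l :
  atlas c -> atlas c' -> cdom c x -> cdom c' x ->
  let tau := transition c' c in let z := cfun c' x in
  let P i j a := partial i (partial j tau) z 0 a in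
  partial i (fun y => metric_in c' y j l) z =
  \sum_a \sum_b (P i j a * metric_in c (cfun c x) a b * jac c' c x l b +
    jac c' c x j a * (\sum_e jac c' c x i e *
        partial e (fun y => metric_in c y a b) (cfun c x)) * jac c' c x l b +
    jac c' c x j a * metric_in c (cfun c x) a b * P i l b).
Proof.
move=> ac ac' cx cx' tau z P.
have oU : open (overlap c' c) by exact: open_overlap.
have oV : open (cran c) by exact: open_cran.
have Uz : overlap c' c z := overlap_cfun cx' cx.
have stau : smooth (overlap c' c) tau := atlas_smooth ac' ac.
have tauV y (Uy : overlap c' c y) : cran c (tau y) := transition_cran Uy.
pose Jf (q : 'I_n) (a : 'I_n) y := partial q tau y 0 a.
have JfC q a : C1on (overlap c' c) (Jf q a).
  exact: smooth_C1on 0 a oU (smooth_derive (delta_mx 0 q) stau).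
pose Gf a b y := metric_in c y a b.
have GfC a b : C1on (cran c) (Gf a b).
  exact: (smooth_C1on a b oV (smooth_metric_in ac)).
have GtC a b := C1on_comp oU oV stau tauV (GfC a b).
pose term a b := (Jf j a \* (Gf a b \o tau)) \* Jf l b.
have termC a b : C1on (overlap c' c) (term a b)
    := C1onM oU (C1onM oU (JfC j a) (GtC a b)) (JfC l b).
have metE y : overlap c' c y -> metric_in c' y j l = \sum_a \sum_b term a b y.
  move=> Uy; have cy := overlap_cran Uy; have cy' := overlap_cdom Uy.
  rewrite -{1}(cinvK cy) (metric_in_change ac ac' cy' (cdom_cinv cy)).
  have JE q a : jac c' c (cinv c' y) q a = Jf q a y.
    by rewrite jac_entry ?cinvK //; exact: cdom_cinv.
  rewrite -[cfun c (cinv c' y)]/(tau y).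
  move: (jac c' c (cinv c' y)) JE => J JE.
  rewrite mxE exchange_big; apply: eq_bigr => b _; rewrite !mxE mulr_suml.
  by apply: eq_bigr => a _; rewrite !JE.
rewrite (@eq_partial _ _ (overlap c' c) _ (fun y => \sum_a \sum_b term a b y)) //.
rewrite (@partial_sum _ _ (overlap c' c)) //; last by move=> a; exact: C1on_sum.
apply: eq_bigr => a _; rewrite (@partial_sum _ _ (overlap c' c)) //.
apply: eq_bigr => b _.
have JE q e : jac c' c x q e = Jf q e z by rewrite jac_entry.
rewrite /term (@partialM _ _ (overlap c' c)) //; last exact: C1onM.
rewrite (@partialM _ _ (overlap c' c)) //.
rewrite (partial_comp oV stau tauV _ (GfC a b) Uz).
have dJ q e : partial i (Jf q e) z = P i q e.
  rewrite /Jf partial_entry //.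
  exact: smooth_differentiable (smooth_derive (delta_mx 0 q) stau) Uz.
have tauz : tau z = cfun c x by exact: transition_cfun.
rewrite !dJ /= tauz !JE; under [X in _ = _ + _ * X * _ + _]eq_bigr do rewrite JE.
rewrite /Gf -/(Jf _ _ _); ring.
Qed.

End ChangeOfCharts.

Section DerivativesInCharts.
Context {R : realType} {n : nat} {M : riemannianManifold R n}.
Implicit Types (c : chart R n M) (x : M) (z : 'rV[R]_n) (f : M -> R).

(** These are the formulas of [differential] and [hessian] in an arbitrary chart. The preferred
    chart may change abruptly from point to point, so continuity has to be studied in one fixed
    chart. *)
Definition gradient_in c f z : 'cV[R]_n := \col_i partial i (f \o cinv c) z.

Definition hessian_in c f z : 'M[R]_n :=
  \matrix_(i, j) (partial i (partial j (f \o cinv c)) z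
    - \sum_k christoffel c z k i j * partial k (f \o cinv c) z).

Section Change.
Variables (c c' : chart R n M).
Hypotheses (ac : atlas c) (ac' : atlas c').

Let oU : open (overlap c' c). Proof. exact: open_overlap. Qed.
Let oV : open (cran c). Proof. exact: open_cran. Qed.
Let stau : smooth (overlap c' c) (transition c' c). Proof. exact: atlas_smooth. Qed.
Let tauV y : overlap c' c y -> cran c (transition c' c y).
Proof. exact: transition_cran. Qed.

Lemma comp_cinv_transition f y : overlap c' c y ->
  (f \o cinv c') y = ((f \o cinv c) \o transition c' c) y.
Proof. by move=> Uy /=; rewrite cinv_transition. Qed.

Lemma C2on_change f : C2on (cran c) (f \o cinv c) ->
  C2on (overlap c' c) (f \o cinv c').
Proof.
move=> fC; apply: eq_C2on (C2on_comp oU oV stau tauV fC) => // y Uy.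
by rewrite comp_cinv_transition.
Qed.

Lemma gradient_change f x : C1on (cran c) (f \o cinv c) ->
  cdom c x -> cdom c' x ->
  gradient_in c' f (cfun c' x) = jac c' c x *m gradient_in c f (cfun c x).
Proof.
move=> fC cx cx'; have Uz := overlap_cfun cx' cx.
have JE q e := jac_entry q e ac' ac cx' cx.
apply/colP => i; rewrite mxE (eq_partial i oU Uz (comp_cinv_transition f)).
rewrite (partial_comp oV stau tauV _ fC Uz).
move: (jac c' c x) JE => J JE; rewrite mxE; apply: eq_bigr => a _.
by rewrite JE mxE transition_cfun.
Qed.

(** [partial2_comp] and [christoffel_change], the latter contracted with the gradient of [f],
    produce the same term in the second derivatives of the transition; it cancels in the difference
    and a tensor law remains. *)
Lemma hessian_change f x : C2on (cran c) (f \o cinv c) ->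
  cdom c x -> cdom c' x ->
  hessian_in c' f (cfun c' x) =
  jac c' c x *m hessian_in c f (cfun c x) *m (jac c' c x)^T.
Proof.
move=> fC cx cx'; have Uz := overlap_cfun cx' cx.
have JE q e := jac_entry q e ac' ac cx' cx.
have metE := metric_in_change ac ac' cx cx'.
have dmetE i j l := partial_metric_change i j l ac ac' cx cx'.
have uG := metric_in_unit ac (cran_cfun cx).
have uJ := jac_unit ac' ac cx' cx.
(* [Schwarz] is a statement on scalar functions, so it is applied to each coordinate of the
   transition map. *)
have Psym i j a : partial i (partial j (transition c' c)) (cfun c' x) 0 a =
    partial j (partial i (transition c' c)) (cfun c' x) 0 a.
  have h q r : partial q (partial r (transition c' c)) (cfun c' x) 0 a =
      partial q (partial r (fun y => transition c' c y 0 a)) (cfun c' x).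
    rewrite -partial_entry; last first.
      exact: smooth_differentiable (smooth_derive (delta_mx 0 r) stau) Uz.
    apply: eq_partial oU Uz _ => y Uy.
    exact/esym/partial_entry/(smooth_differentiable stau Uy).
  have sC : C2on (overlap c' c) (fun y => transition c' c y 0 a).
    exact: smooth_C2on.
  exact: etrans (h i j) (etrans (Schwarz i j oU sC Uz) (esym (h j i))).
have := christoffel_change (fun k => partial k (f \o cinv c) (cfun c x))
  Psym (metric_in_sym c (cfun c x)) uG uJ dmetE.
rewrite -metE => chE.
have fE := comp_cinv_transition f.
apply/matrixP => i j; rewrite mxE.
have -> : \sum_k christoffel c' (cfun c' x) k i j * partial k (f \o cinv c') (cfun c' x) =
    \sum_k (2^-1 * \sum_l invmx (metric_in c' (cfun c' x)) k l *
      (partial i (fun y => metric_in c' y j l) (cfun c' x) +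
       partial j (fun y => metric_in c' y i l) (cfun c' x) -
       partial l (fun y => metric_in c' y i j) (cfun c' x))) *
     (\sum_a jac c' c x k a * partial a (f \o cinv c) (cfun c x)).
  apply: eq_bigr => k _; congr (_ * _).
  rewrite (eq_partial k oU Uz fE) (partial_comp oV stau tauV _ fC.1 Uz).
  by apply: eq_bigr => a _; rewrite JE transition_cfun.
rewrite chE.
have -> : partial i (partial j (f \o cinv c')) (cfun c' x) =
    partial i (partial j ((f \o cinv c) \o transition c' c)) (cfun c' x).
  by apply: eq_partial oU Uz _ => y Uy; exact: eq_partial oU Uy fE.
rewrite (partial2_comp oU oV stau tauV fC _ _ Uz).
rewrite (transition_cfun c cx').
move: (jac c' c x) JE => J JE.
rewrite big_split /= opprD addrACA subrr add0r.
rewrite !mxE; under [RHS]eq_bigr do rewrite !mxE.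
rewrite -sumrB; apply: eq_bigr => a _.
rewrite mulr_sumr mulr_suml -sumrB; apply: eq_bigr => b _.
by rewrite mxE !JE /christoffel /=; ring.
Qed.

End Change.

(** With the preferred chart as target, the change of charts writes the intrinsic object through
    [cotangent_of], the form in which [continuous_on_chi] presents the arguments of [F]. The same is
    done for Hessians below. *)
Lemma differential_of c f x : atlas c -> cdom c x ->
  C1on (cran c) (f \o cinv c) ->
  differential f x = cotangent_of c x (gradient_in c f (cfun c x)).
Proof.
move=> ac cx fC.
exact: gradient_change ac (chart_at_atlas x) _ _ fC cx (chart_at_dom x).
Qed.

Lemma hessian_of c f x : atlas c -> cdom c x ->
  C2on (cran c) (f \o cinv c) ->
  hessian f x = bilinear_form_of c x (hessian_in c f (cfun c x)).
Proof.
move=> ac cx fC.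
exact: hessian_change ac (chart_at_atlas x) _ _ fC cx (chart_at_dom x).
Qed.

Lemma christoffel_sym c z k i j : christoffel c z k i j = christoffel c z k j i.
Proof.
rewrite /christoffel; congr (_ * _); apply: eq_bigr => l _; congr (_ * _).
rewrite [X in _ - X](_ : _ = partial l (fun y => metric_in c y j i) z).
  by rewrite [X in X - _]addrC.
congr partial; apply/funext => y.
by rewrite -[in LHS]metric_in_sym mxE.
Qed.

(** Keeps the jets inside [chi_in], whose forms are symmetric and on which alone [F] is
    continuous. *)
Lemma hessian_in_sym c f z : C2on (cran c) (f \o cinv c) -> cran c z ->
  (hessian_in c f z)^T = hessian_in c f z.
Proof.
move=> fC cz; apply/matrixP => i j; rewrite !mxE.
rewrite (Schwarz i j (open_cran c) fC cz); congr (_ - _).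
by apply: eq_bigr => k _; rewrite christoffel_sym.
Qed.

Lemma christoffel_continuous c z k i j : atlas c -> cran c z ->
  {for z, continuous (fun y => christoffel c y k i j)}.
Proof.
move=> ac cz; have oV := open_cran c.
have dG a b : C1on (cran c) (fun y => metric_in c y a b).
  exact: smooth_C1on a b oV (smooth_metric_in ac).
rewrite /prop_for /continuous_at /christoffel.
apply: (@cvgMl_tmp _ _ (nbhs z)).
apply: (@cvg_sum _ _ (nbhs z)) => l; apply: cvgM.
  apply: cvg_entry; apply: cvg_invmx; first exact: metric_in_unit.
  exact: smooth_continuous (smooth_metric_in ac) cz.
by apply: cvgB; [apply: cvgD|]; exact: C1on_cts_partial (dG _ _) cz.
Qed.

End DerivativesInCharts.

(** * Bump functions *)

(** In every sign case the error of the first-order expansion is at most [h ^+ 2], so the quotient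
    is within [|h|] of its limit, also at the kink [s = 0]. *)
Lemma is_derive_pos_sqr (R : realType) (s : R) :
  is_derive s 1 (fun t : R => Num.max 0 t ^+ 2) (2 * Num.max 0 s).
Proof.
suff H : h^-1 *: (((fun t : R => Num.max 0 t ^+ 2) \o shift s) (h *: 1) -
    Num.max 0 s ^+ 2) @[h --> (0 : R)^'] --> 2 * Num.max 0 s.
  by split; [apply/cvg_ex; exists (2 * Num.max 0 s)|exact: cvg_lim H].
apply/cvgrPdistC_le => e e0; near=> h.
have h0 : h != 0 by near: h; exact: nbhs_dnbhs_neq.
have he : `|h| <= e by near: h; exact: dnbhs0_le.
apply: le_trans he; rewrite /= [h *: 1]mulr1.
have -> : h^-1 *: (Num.max 0 (h + s) ^+ 2 - Num.max 0 s ^+ 2) - 2 * Num.max 0 s =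
    h^-1 * (Num.max 0 (h + s) ^+ 2 - Num.max 0 s ^+ 2 - 2 * Num.max 0 s * h).
  by rewrite [_ *: _]mulrBr mulrBr; field.
rewrite normrM normfV -(ler_pM2l (_ : 0 < `|h|)) ?normr_gt0 //.
rewrite mulrA divff ?normr_eq0 // mul1r -expr2 real_normK ?num_real // ler_norml.
by case: (leP 0 (h + s)) => ?; case: (leP 0 s) => ?; apply/andP; split; nra.
Unshelve. all: by end_near.
Qed.

(** The cube is [t] times the square of the positive part, both sides vanishing for negative [t]. *)
Lemma is_derive_pos_cube (R : realType) (s : R) :
  is_derive s 1 (fun t : R => Num.max 0 t ^+ 3) (3 * Num.max 0 s ^+ 2).
Proof.
rewrite (_ : (fun t => _) = id \* (fun t : R => Num.max 0 t ^+ 2)); last first.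
  by apply/funext => t /=; case: (leP 0 t) => ?; rewrite ?exprS ?mul0r ?mulr0.
have [d1 d2] := is_deriveM (is_derive_id s 1) (is_derive_pos_sqr s).
split; [exact: d1|rewrite [LHS]d2]; rewrite /GRing.scale /=.
by case: (leP 0 s) => ?; rewrite ?expr2; ring.
Qed.

Lemma continuous_pos (R : realType) : continuous (fun t : R => Num.max 0 t).
Proof.
by move=> t; apply: (@continuous_max _ _ (cst 0) id); [exact: cst_continuous|].
Qed.

Section ScalarComposition.
Context {R : realType} {n : nat}.
Variables (V : set 'rV[R]_n) (f : 'rV[R]_n -> R) (g g' : R -> R).
Hypotheses (oV : open V) (fV : C1on V f).
Hypothesis gg' : forall s : R, is_derive s 1 g (g' s).

Lemma is_derive_scalar_comp y i : V y ->
  is_derive y (delta_mx 0 i) (g \o f) (g' (f y) * partial i f y).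
Proof.
move=> Vy; have df := C1on_differentiable oV fV Vy.
have dg : differentiable g (f y) by apply/derivable1_diffP; case: (gg' (f y)).
have dc : differentiable (g \o f) y by exact: differentiable_comp.
suff <- : 'D_(delta_mx 0 i) (g \o f) y = g' (f y) * partial i f y.
  exact/derivableP/diff_derivable.
rewrite (derive_compE _ df dg) (deriveE _ dg) -/(partial i f y).
rewrite -{1}[partial i f y]mulr1.
have -> : 'd g (f y) (partial i f y * 1) = partial i f y * 'd g (f y) 1.
  exact: (linearZZ ('d g (f y))).
by rewrite -(deriveE _ dg) mulrC; case: (gg' (f y)) => _ ->.
Qed.

Lemma partial_scalar_comp y i : V y ->
  partial i (g \o f) y = g' (f y) * partial i f y.
Proof. by move=> /is_derive_scalar_comp h; case: (h i). Qed.

Lemma C1on_scalar_comp : continuous g' -> C1on V (g \o f).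
Proof.
move=> cg'; apply: (@C1onP _ _ V _ (fun i y => g' (f y) * partial i f y)) => //.
  by move=> y i; exact: is_derive_scalar_comp.
move=> y i Vy; apply: (@cvgM _ _ (nbhs y)); last exact: C1on_cts_partial Vy.
by apply: continuous_comp; [exact: C1on_continuous Vy|exact: cg'].
Qed.

End ScalarComposition.

Section EuclideanBump.
Context {R : realType} {n : nat}.
Variables (a : 'rV[R]_n) (r : R).
Hypothesis r0 : 0 < r.

Let f (z : 'rV[R]_n) : R := r ^+ 2 - \sum_i (z 0 i - a 0 i) ^+ 2.

(** The norm on row vectors is the maximum norm, which is not smooth, hence the sum of squares.
    Exponent 3 is the smallest integer power that is C^2 across the sphere of radius [r]. *)
Definition eucl_bump (z : 'rV[R]_n) : R :=
  Num.max 0 (r ^+ 2 - \sum_i (z 0 i - a 0 i) ^+ 2) ^+ 3.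

Let coord i : C1on setT (fun z : 'rV[R]_n => z 0 i).
Proof.
apply: (@C1onP _ _ setT _ (fun j _ => (i == j)%:R)); first exact: openT.
  move=> y j _; have := is_derive_id y (delta_mx 0 j : 'rV[R]_n).
  move=> [d e]; have /derivable_mxP/(_ 0 i) di := d.
  have := derive_mx d; rewrite e => /rowP/(_ i); rewrite !mxE /= => e'.
  by split; [exact: di|exact/esym/e'].
by move=> y j _; exact: cst_continuous.
Qed.

Let partial_coord i j z : partial j (fun z : 'rV[R]_n => z 0 i) z = (i == j)%:R.
Proof.
have [d e] := is_derive_id z (delta_mx 0 j : 'rV[R]_n).
by have := derive_mx d; rewrite e => /rowP/(_ i); rewrite !mxE.
Qed.

Let fsum (z : 'rV[R]_n) : f z = (cst (r ^+ 2) \+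
  (fun z : 'rV[R]_n => \sum_i (cst (-1) \* ((fun z : 'rV[R]_n => z 0 i - a 0 i) \*
    (fun z : 'rV[R]_n => z 0 i - a 0 i))) z)) z.
Proof. by rewrite /f /= -sumrN; congr (_ + _); apply: eq_bigr => i _; ring. Qed.

Let coordB i : C1on setT (fun z : 'rV[R]_n => z 0 i - a 0 i).
Proof. exact: (C1onD openT (coord i) (@C1on_cst _ _ setT (- a 0 i))). Qed.

Let partial_coordB i j z :
  partial j (fun z : 'rV[R]_n => z 0 i - a 0 i) z = (i == j)%:R.
Proof.
have := @partialD _ _ setT _ (cst (- a 0 i)) z j (coord i) (@C1on_cst _ _ setT (- a 0 i)) I.
by rewrite /= partial_coord => ->; rewrite [partial _ _ _]derive_cst addr0.
Qed.

Let fC : C1on setT f.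
Proof.
apply: (@eq_C1on _ _ setT _ _ openT (fun z _ => esym (fsum z))).
apply: (C1onD openT (@C1on_cst _ _ _ _)); apply: (C1on_sum openT) => i.
apply: (C1onM openT (@C1on_cst _ _ _ _)); exact: (C1onM openT).
Qed.

Let partial_f j z : partial j f z = -2 * (z 0 j - a 0 j).
Proof.
pose g i : 'rV[R]_n -> R := fun z => z 0 i - a 0 i.
have cC (t : R) : C1on setT (cst t : 'rV[R]_n -> R) by exact: C1on_cst.
have ggC i : C1on setT (g i \* g i) by exact: C1onM openT (coordB i) (coordB i).
have tC i : C1on setT (cst (-1) \* (g i \* g i)) by exact: C1onM openT (cC _) (ggC i).
have sC : C1on setT (fun z => \sum_i (cst (-1) \* (g i \* g i)) z).
  exact: C1on_sum openT tC.
have tE i : partial j (cst (-1) \* (g i \* g i)) z = -2 * g i z * (i == j)%:R.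
  have := @partialM _ _ setT _ _ z j (cC (-1)) (ggC i) I.
  have := @partialM _ _ setT _ _ z j (coordB i) (coordB i) I.
  have -> : partial j (cst (-1) : 'rV[R]_n -> R) z = 0 by exact: derive_cst.
  rewrite partial_coordB /= => -> ->; rewrite /g /=; ring.
have := @eq_partial _ _ setT _ _ z j openT I (fun z _ => fsum z).
have := @partialD _ _ setT _ _ z j (cC (r ^+ 2)) sC I.
have -> : partial j (cst (r ^+ 2) : 'rV[R]_n -> R) z = 0 by exact: derive_cst.
have := @partial_sum _ _ setT _ (fun i => cst (-1) \* (g i \* g i)) z j openT tC I.
move=> -> -> ->; rewrite add0r (bigD1 j) //= big1 ?addr0 => [|i ij].
  by rewrite tE eqxx mulr1.
by rewrite tE (negbTE ij) mulr0.
Qed.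

Lemma partial_eucl_bump j z : partial j eucl_bump z =
  3 * Num.max 0 (f z) ^+ 2 * (-2 * (z 0 j - a 0 j)).
Proof.
have := @partial_scalar_comp _ _ setT f (fun t => Num.max 0 t ^+ 3) _ openT fC
  (@is_derive_pos_cube R) z j I.
by rewrite partial_f.
Qed.

Lemma eucl_bump_C2 : C2on setT eucl_bump.
Proof.
have cpos2 : continuous (fun t : R => 3 * Num.max 0 t ^+ 2).
  move=> t; apply: cvgMl_tmp; apply: (@cvgM _ _ (nbhs t)); exact: continuous_pos.
split=> [|j].
  exact: C1on_scalar_comp openT fC (@is_derive_pos_cube R) cpos2.
have C2 : C1on setT ((fun t => Num.max 0 t ^+ 2) \o f).
  apply: C1on_scalar_comp openT fC (@is_derive_pos_sqr R) _.
  by move=> t; apply: cvgMl_tmp; exact: continuous_pos.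
have C := C1onM openT (@C1on_cst _ _ setT (-6)) (C1onM openT C2 (coordB j)).
apply: eq_C1on openT _ C => z _; rewrite partial_eucl_bump /=; ring.
Qed.

Lemma eucl_bump_ge0 z : 0 <= eucl_bump z.
Proof. by rewrite exprn_ge0 // le_max lexx. Qed.

Lemma eucl_bump_center : eucl_bump a = r ^+ 6.
Proof.
rewrite /eucl_bump big1 => [|i _]; last by rewrite subrr expr0n.
by rewrite subr0 max_r ?exprn_ge0 ?(ltW r0) // -exprM.
Qed.

Lemma norm_sqr_le_eucl (z : 'rV[R]_n) : `|z - a| ^+ 2 <= \sum_i (z 0 i - a 0 i) ^+ 2.
Proof.
set s := \sum_i _; have s0 : 0 <= s by apply: sumr_ge0 => i _; exact: sqr_ge0.
rewrite -[s]sqr_sqrtr // lerXn2r ?nnegrE ?sqrtr_ge0 //.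
apply: ler_norm_entries => [|i j]; first exact: sqrtr_ge0.
rewrite !mxE ord1 -sqrtr_sqr ler_wsqrtr // /s (bigD1 j) //= lerDl.
by apply: sumr_ge0 => k _; exact: sqr_ge0.
Qed.

(** Used with [d = r] for vanishing away from [a], with [d = 0] for the maximum at [a], and with
    small [d] for its strictness. The maximum norm is below the Euclidean one, so the bound is in
    the right direction. *)
Lemma eucl_bump_out d z : 0 <= d -> d <= `|z - a| ->
  eucl_bump z <= Num.max 0 (r ^+ 2 - d ^+ 2) ^+ 3.
Proof.
move=> d0 dz; apply: lerXn2r; rewrite ?nnegrE;
  [by rewrite le_max lexx|by rewrite le_max lexx|].
rewrite ge_max !le_max lexx /= lerD2l lerN2; apply/orP; right.
by apply: le_trans (norm_sqr_le_eucl z); rewrite lerXn2r ?nnegrE.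
Qed.

Lemma eucl_bump_eq0 z : r <= `|z - a| -> eucl_bump z = 0.
Proof.
move=> rz; apply/eqP; rewrite eq_le eucl_bump_ge0 andbT.
by apply: le_trans (eucl_bump_out (ltW r0) rz) _; rewrite subrr maxxx expr0n.
Qed.

(** Where the bump is nonzero, the positive part is at most [r ^+ 2] and each coordinate of [z - a]
    at most [r], so the derivative [3 m^2 * 2 (z_j - a_j)] is at most [6 r^5]. *)
Lemma partial_eucl_bump_bound j z :
  `|partial j eucl_bump z| <= 6 * r ^+ 5.
Proof.
rewrite partial_eucl_bump; set m := Num.max 0 (f z).
have m0 : 0 <= m by rewrite le_max lexx.
have mr : m <= r ^+ 2.
  rewrite ge_max sqr_ge0 /= /f gerBl; apply: sumr_ge0 => i _; exact: sqr_ge0.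
have [rz|zr] := leP r `|z - a|.
  suff -> : m = 0 by rewrite expr0n mulr0 mul0r normr0 mulr_ge0 // exprn_ge0 // ltW.
  have := eucl_bump_eq0 rz; rewrite /eucl_bump -/(f z) -/m => /eqP.
  by rewrite expf_eq0 => /andP[_ /eqP].
have zj : `|z 0 j - a 0 j| <= r.
  by apply: le_trans (ltW zr); have := ler_entry_norm (z - a) 0 j; rewrite !mxE.
rewrite !normrM (ger0_norm m0) normrN !normr_nat.
rewrite (_ : 6 * r ^+ 5 = 3 * (r ^+ 2 * r ^+ 2) * (2 * r)); last by ring.
apply: ler_pM => //; rewrite ?mulr_ge0 // ler_wpM2l //.
by apply: ler_pM.
Qed.

End EuclideanBump.

Section ClosedBall.
Context {R : realType} {n : nat} {X : topologicalType}.
Implicit Types (c : chart R n X).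

Lemma compact_cball (a : 'rV[R]_n) (r : R) : compact [set z | `|z - a| <= r].
Proof.
apply: bounded_closed_compact.
  exists (`|a| + `|r|); split; first exact: num_real.
  move=> M rM z zr; apply: le_trans (ltW rM).
  rewrite -[z](subrK a) addrC; apply: le_trans (ler_normD _ _) _.
  by rewrite lerD2l (le_trans zr) ?ler_norm.
apply: (@closed_comp _ _ (fun z : 'rV[R]_n => `|z - a|) [set x | x <= r]);
  last exact: closed_le.
move=> z _; apply: (@cvg_norm _ _ _ (nbhs z)).
by apply: (@cvgB _ _ _ (nbhs z)); [exact: cvg_id|exact: cvg_cst].
Qed.

Lemma chart_cball c x : cdom c x ->
  exists2 r : R, 0 < r & [set z | `|z - cfun c x| <= r] `<=` cran c.
Proof.
move=> cx; have /nbhs_ballP[d /= d0 dc] := nbhs_cran (cran_cfun cx).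
exists (d / 2); first exact: divr_gt0.
move=> z /= zr; apply: dc; rewrite -ball_normE /= distrC.
by apply: le_lt_trans zr _; rewrite ltr_pdivrMr // ltr_pMr // ltr1n.
Qed.

Lemma compact_cinv_image c (B : set 'rV[R]_n) :
  compact B -> B `<=` cran c -> compact (cinv c @` B).
Proof.
move=> cB Bc; apply: continuous_compact => //.
apply: continuous_in_subspaceT => z /set_mem /Bc; exact: continuous_cinv.
Qed.

End ClosedBall.

Section Bump.
Context {R : realType} {n : nat} {M : riemannianManifold R n}.
Variables (c : chart R n M) (x0 : M) (r : R).
Hypotheses (ac : atlas c) (cx0 : cdom c x0) (r0 : 0 < r).
Let a := cfun c x0.
Hypothesis rc : [set z | `|z - a| <= r] `<=` cran c.
Let B := [set z : 'rV[R]_n | `|z - a| <= r].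
Let K := cinv c @` B.

Definition bump (y : M) : R :=
  if y \in cdom c then eucl_bump a r (cfun c y) else 0.

Let closedK : closed K.
Proof.
apply: compact_closed; first exact: manifold_hausdorff.
by apply: compact_cinv_image => //; exact: compact_cball.
Qed.

Let bump_eq0 y : ~ K y -> bump y = 0.
Proof.
rewrite /bump; case: ifPn => // /set_mem cy nK; apply: eucl_bump_eq0 => //.
rewrite leNgt; apply/negP => yr; apply: nK; exists (cfun c y); last exact: cfunK.
exact: ltW.
Qed.

Let bump_chart z : cran c z -> eucl_bump a r z = (bump \o cinv c) z.
Proof. by move=> cz; rewrite /bump /= mem_set ?cinvK //; exact: cdom_cinv. Qed.

Let bump_chart_C2 : C2on (cran c) (bump \o cinv c).
Proof.
apply: eq_C2on (open_cran c) bump_chart _.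
by apply: sub_C2on (eucl_bump_C2 a r).
Qed.

Let open_out (c' : chart R n M) : open (cran c' `&` cinv c' @^-1` ~` K).
Proof.
rewrite openE => z [cz nK]; apply: filterI; first exact: nbhs_cran.
apply: (continuous_cinv cz); apply: open_nbhs_nbhs; split => //.
exact: closed_openC.
Qed.

(** The support lies in [K], compact in a Hausdorff space and hence closed. A point outside the
    domain of [c] is therefore outside [K] and has a neighbourhood on which the bump is zero;
    elsewhere the change of charts applies. *)
Lemma bump_C2 (c' : chart R n M) : atlas c' -> C2on (cran c') (bump \o cinv c').
Proof.
move=> ac'; apply: C2on_local => z cz.
have [cy|ncy] := pselect (cdom c (cinv c' z)).
  exists (overlap c' c); first by rewrite overlapE.
  exact: C2on_change ac ac' _ bump_chart_C2.
exists (cran c' `&` cinv c' @^-1` ~` K).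
  by split=> //= -[w Bw wz]; apply: ncy; rewrite -wz; apply: cdom_cinv; exact: rc.
apply: (@eq_C2on R n _ (cst 0)) => [|w [_ nK]|]; first exact: open_out.
  by rewrite /= bump_eq0.
split=> [|i]; first exact: C1on_cst.
apply: (@eq_C1on R n _ (cst 0)) => [|w _|]; [exact: open_out| |exact: C1on_cst].
by rewrite [RHS]derive_cst.
Qed.

Lemma bump_le y : bump y <= bump x0.
Proof.
have -> : bump x0 = r ^+ 6 by rewrite /bump mem_set // eucl_bump_center.
have -> : r ^+ 6 = Num.max 0 (r ^+ 2 - 0 ^+ 2) ^+ 3.
  by rewrite expr0n subr0 max_r ?sqr_ge0 // -exprM.
rewrite /bump; case: ifPn => _; first exact: eucl_bump_out.
by rewrite exprn_ge0 // le_max lexx.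
Qed.

(** [U] contains the image of a chart ball of radius [d]. Outside it the bump is at most
    [m ^+ 3 < r ^+ 6], and outside the chart it is zero, so the gap [e] is uniform. *)
Lemma bump_strict_max U : nbhs x0 U ->
  exists2 e, 0 < e & forall y, ~ U y -> bump y <= bump x0 - e.
Proof.
move=> Ux; have Ua : nbhs a (cinv c @^-1` U).
  by apply: (continuous_cinv (cran_cfun cx0)); rewrite cfunK.
have /nbhs_ballP[d0 /= d00 dU] := Ua.
pose d := Num.min d0 r; have dgt0 : 0 < d by rewrite lt_min d00.
have bx0 : bump x0 = r ^+ 6 by rewrite /bump mem_set // eucl_bump_center.
pose m := Num.max 0 (r ^+ 2 - d ^+ 2).
exists (r ^+ 6 - m ^+ 3).
  have -> : r ^+ 6 = (r ^+ 2) ^+ 3 by rewrite -exprM.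
  have m0 : 0 <= m by rewrite le_max lexx.
  rewrite subr_gt0 ltr_pXn2r ?nnegrE ?sqr_ge0 //.
  by rewrite gt_max exprn_gt0 //= gtrBl exprn_gt0.
move=> y nU; rewrite bx0 subKr /bump; case: ifPn => [/set_mem cy|_]; last first.
  by rewrite exprn_ge0 // le_max lexx.
apply: eucl_bump_out; first exact: ltW.
rewrite leNgt; apply/negP => yd; apply: nU.
rewrite -(cfunK cy); apply: dU; rewrite -ball_normE /= distrC.
by apply: lt_le_trans yd _; rewrite ge_min lexx.
Qed.

(** The quadratic form is homogeneous of degree 2, so its minimum over the compact product of [B]
    with the unit sphere serves as [l]. *)
Let metric_lower_bound : exists2 l : R, 0 < l & forall (z v : 'rV[R]_n), B z ->
  l * `|v| ^+ 2 <= (v *m metric_in c z *m v^T) 0 0.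
Proof.
pose S := B `*` [set v : 'rV[R]_n | `|v| = 1].
have cS : compact S.
  apply: compact_setX; first exact: compact_cball.
  apply: (@subclosed_compact _ _ [set v : 'rV[R]_n | `|v - 0| <= 1]).
  - apply: (@closed_comp _ _ (fun z : 'rV[R]_n => `|z|) [set x : R | x = 1]).
      by move=> v _; exact: norm_continuous.
    exact: closed_eq.
  - exact: compact_cball.
  - by move=> v /= v1; rewrite subr0 v1.
pose q (p : 'rV[R]_n * 'rV[R]_n) : R := (p.2 *m metric_in c p.1 *m p.2^T) 0 0.
have cq : {within S, continuous q}.
  apply: continuous_in_subspaceT => -[z v] /set_mem[Bz _].
  apply: (@cvg_entry _ _ (nbhs (z, v))); apply: cvg_mulmx; last first.
    by apply: cvg_trmx; exact: cvg_snd.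
  apply: cvg_mulmx; first exact: cvg_snd.
  apply: (@continuous_comp _ _ _ fst (metric_in c)); first exact: cvg_fst.
  exact: smooth_continuous (smooth_metric_in ac) (rc Bz).
(* The unit sphere is empty in dimension 0; then every [v] is zero and any [l] will do. *)
have [S0|/set0P/negP/negPn/eqP S0] := pselect (S !=set0); last first.
  exists 1 => // z v Bz; have [->|v0] := eqVneq v 0.
    by rewrite normr0 expr0n mulr0 !mul0mx mxE.
  exfalso; suff : S (z, `|v|^-1 *: v) by rewrite S0.
  by split => //=; rewrite normrZ normfV normr_id mulVf // normr_eq0.
have [[z1 v1] /set_mem[/= Bz1 v11] minS] := compact_EVT_min S0 cS cq.
exists (q (z1, v1)).
  apply: metric_in_posdef => //; first exact: rc.
  by rewrite -normr_eq0 v11 oner_eq0.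
move=> z v Bz; have [->|v0] := eqVneq v 0.
  by rewrite normr0 expr0n mulr0 !mul0mx mxE.
have nv : `|v| != 0 by rewrite normr_eq0.
have /mem_set/minS : S (z, `|v|^-1 *: v).
  by split => //=; rewrite normrZ normfV normr_id mulVf.
rewrite {2}/q /= linearZ /= -!scalemxAl -scalemxAr mxE [X in _ * X]mxE mulrA.
by rewrite -expr2 exprVn mulrC ler_pdivlMr // exprn_gt0 // normr_gt0.
Qed.

(** Off [K] the differential is zero. On [K], in the chart [c], the [n] components of the gradient
    are at most [6 r^5], and [metric_lower_bound] bounds the coordinates of [v] by its Riemannian
    norm divided by [Num.sqrt l]. *)
Lemma bump_differential_bound : exists2 C : R, 0 <= C &
  forall (y : M) (v : tangent y), `|(v *m differential bump y) 0 0| <=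
    C * Num.sqrt ((v *m Defs.metric y *m v^T) 0 0).
Proof.
have [l l0 lP] := metric_lower_bound.
pose D := n%:R * (6 * r ^+ 5).
have D0 : 0 <= D by rewrite mulr_ge0 // mulr_ge0 // exprn_ge0 // ltW.
exists (D / Num.sqrt l); first by rewrite divr_ge0 // sqrtr_ge0.
move=> y v; have [Ky|nK] := pselect (K y); last first.
  suff -> : differential bump y = 0.
    by rewrite mulmx0 mxE normr0 mulr_ge0 ?sqrtr_ge0 // divr_ge0 // sqrtr_ge0.
  have [ac' cy'] := (chart_at_atlas y, chart_at_dom y).
  apply/colP => i; rewrite !mxE.
  transitivity (partial i (cst 0 : 'rV[R]_n -> R) (cfun (chart_at y) y));
    last exact: derive_cst.
  have oW : open (cran (chart_at y) `&` cinv (chart_at y) @^-1` ~` K) by exact: open_out.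
  apply: eq_partial oW _ _.
    by split=> /=; [exact: cran_cfun|rewrite cfunK].
  by move=> w [_ /bump_eq0].
have [z Bz zy] := Ky; have cz := rc Bz.
have cy : cdom c y by rewrite -zy; exact: cdom_cinv.
have zE : cfun c y = z by rewrite -zy cinvK.
have -> := differential_of ac cy bump_chart_C2.1.
have := metric_in_change ac (chart_at_atlas y) cy (chart_at_dom y).
rewrite metric_in_chart_at zE /cotangent_of => ->.
have := lP z ^~ Bz; move: (metric_in c z) (jac _ _ _) => G J {}lP.
rewrite !mulmxA -(mulmxA _ J^T) -trmx_mul.
move: (v *m J) => w {v J}.
have gb i : `|gradient_in c bump z i 0| <= 6 * r ^+ 5.
  rewrite mxE -(eq_partial i (open_cran c) cz bump_chart).
  exact: partial_eucl_bump_bound.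
apply: (@le_trans _ _ (D * `|w|)).
  rewrite mxE; apply: le_trans (ler_norm_sum _ _ _) _.
  rewrite /D -mulrA mulr_natl -[X in _ *+ X]card_ord -sumr_const.
  by apply: ler_sum => i _; rewrite normrM mulrC; apply: ler_pM => //; exact: ler_entry_norm.
rewrite -mulrA; apply: ler_wpM2l => //.
rewrite ler_pdivlMl ?sqrtr_gt0 // -[`|w|]ger0_norm // -sqrtr_sqr -sqrtrM; last exact: ltW.
by rewrite ler_wsqrtr // lP.
Qed.

End Bump.

(** * Curves and the Riemannian distance *)

(* Unlike [ge0_le_integral] this needs no measurability, which would have to be
   proved for the speed of an arc: both sides are suprema over simple functions. *)
Lemma ge0_le_integral_nonmeas d (T : measurableType d) (R : realType)
    (mu : {measure set T -> \bar R}) (D : set T) (f g : T -> \bar R) :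
  (forall x, D x -> 0 <= f x)%E -> (forall x, D x -> f x <= g x)%E ->
  (\int[mu]_(x in D) f x <= \int[mu]_(x in D) g x)%E.
Proof.
move=> f0 fg; have g0 x : D x -> (0 <= g x)%E.
  by move=> Dx; exact: le_trans (f0 x Dx) (fg x Dx).
rewrite !ge0_integralE //; apply: ge_ereal_sup => _ [h hf <-].
apply: ereal_sup_ubound; exists h => // x; apply: le_trans (hf x) _.
by rewrite /patch; case: ifPn => // /set_mem /fg.
Qed.

Section DerivWithin.
Context {R : realType}.
Implicit Types (D : set R).

(** Makes limits of difference quotients unique on a closed interval, endpoints included: points
    approach from the right when [t < b] and from the left when [t = b]. *)
Lemma within_itv_dnbhs_proper (a b t : R) : a < b -> `[a, b]%classic t ->
  ProperFilter (within `[a, b] t^').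
Proof.
move=> ab; rewrite /= in_itv /= => /andP[at_ tb].
apply: Build_ProperFilter_ex => P /nbhs_ballP[e /= e0 eP].
have [tltb|tgeb] := ltP t b.
  pose s := t + Num.min (e / 2) (b - t).
  have m0 : 0 < Num.min (e / 2) (b - t) by rewrite lt_min divr_gt0 //= subr_gt0.
  exists s; apply: (eP s).
  - rewrite -ball_normE /= opprD addNKr normrN gtr0_norm //.
    by rewrite gt_min; apply/orP; left; lra.
  - by rewrite /s -subr_eq0 addrAC subrr add0r gt_eqF.
  - rewrite /= in_itv /= /s; apply/andP; split; first by rewrite (le_trans at_) // lerDl ltW.
    by rewrite -lerBrDl ge_min lexx orbT.
have tE : t = b by apply/eqP; rewrite eq_le tb.
pose s := t - Num.min (e / 2) (t - a).
have m0 : 0 < Num.min (e / 2) (t - a) by rewrite lt_min divr_gt0 //= subr_gt0 tE.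
exists s; apply: (eP s).
- rewrite -ball_normE /= opprB addrC subrK gtr0_norm //.
  by rewrite gt_min; apply/orP; left; lra.
- by rewrite /s -subr_eq0 addrAC subrr add0r oppr_eq0 gt_eqF.
- rewrite /= in_itv /= /s; apply/andP; split; last by rewrite (le_trans _ tb) // gerBl ltW.
  by rewrite lerBrDl -lerBrDr ge_min lexx orbT.
Qed.

Lemma deriv_withinE {W : normedModType R} (a b t : R) (f : R -> W) (l : W) : a < b ->
  `[a, b]%classic t -> quotients_within `[a, b] f t --> l ->
  deriv_within `[a, b] f t = l.
Proof.
move=> ab tab fl; have PF := within_itv_dnbhs_proper ab tab.
exact: (@cvg_lim _ (@norm_hausdorff _ _)).
Qed.

Lemma derivable_withinP {W : normedModType R} D (f : R -> W) t :
  derivable_within D f t -> quotients_within D f t --> deriv_within D f t.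
Proof. by []. Qed.

Lemma near_within_dnbhs_sub D t : \forall s \near within D t^', s - t != 0.
Proof.
by rewrite near_withinE /dnbhs near_withinE; near=> s => /= st _; rewrite subr_eq0.
Unshelve. all: by end_near. Qed.

Lemma quotients_within_increment {W : normedModType R} D (f : R -> W) (t : R) (l : W) :
  quotients_within D f t --> l -> (f s - f t) @[s --> within D t^'] --> (0 : W).
Proof.
move=> fl.
have st0 : s - t @[s --> within D t^'] --> (0 : R).
  have : {for t, continuous (fun s : R => s - t)}.
    by apply: continuousB => //; exact: cst_continuous.
  by rewrite /prop_for /continuous_at subrr => st; do 2 apply: cvg_within_filter.
have H : (s - t) *: ((s - t)^-1 *: (f s - f t)) @[s --> within D t^'] --> (0 : W).
  by have := cvgZ st0 fl; rewrite scale0r; apply.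
apply: cvg_trans H; apply: near_eq_cvg.
near=> s; rewrite scalerA divff ?scale1r //.
by near: s; exact: near_within_dnbhs_sub.
Unshelve. all: by end_near. Qed.

Lemma quotients_within_continuous {W : normedModType R} D (f : R -> W) (t : R) (l : W) :
  quotients_within D f t --> l -> f s @[s --> within D (nbhs t)] --> f t.
Proof.
move=> /quotients_within_increment /cvgrPdist_lt fl.
apply/cvgrPdist_lt => e e0.
have : \forall s \near within D t^', `|0 - (f s - f t)| < e by exact: fl.
rewrite !near_withinE; apply: filterS => s H Ds.
have [->|st] := eqVneq s t; first by rewrite subrr normr0.
by have := H st Ds; rewrite sub0r normrN distrC.
Qed.

Lemma near_eq_quotients_within {W : normedModType R} D (f g : R -> W) (t : R) (l : W) :
  D t -> (\forall s \near within D (nbhs t), f s = g s) ->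
  quotients_within D f t --> l -> quotients_within D g t --> l.
Proof.
move=> Dt fg; apply: cvg_trans; apply: near_eq_cvg.
have e : f t = g t.
  by move: fg; rewrite near_withinE => /nbhs_singleton; apply.
move: fg; rewrite !near_withinE.
by apply: filterS => s H st Ds; rewrite e H.
Qed.

(** The inner function has a derivative only within [D], while the outer one is differentiable in
    full. Its remainder is small relative to [f s - f t], and the quotients of [f] are eventually
    bounded by [|l| + 1]. *)
Lemma quotients_within_comp {V W : normedModType R} D (f : R -> V) (g : V -> W)
    (t : R) (l : V) :
  quotients_within D f t --> l -> differentiable g (f t) ->
  quotients_within D (g \o f) t --> 'd g (f t) l.
Proof.
move=> fl dg; have finc := quotients_within_increment fl.
have cdg : continuous ('d g (f t)) by exact: diff_continuous.
pose rest v := g (v + f t) - g (f t) - 'd g (f t) v.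
have restP (e : R) : 0 < e -> \forall v \near (0 : V), `|rest v| <= e * `|v|.
  move=> e0; have /diff_locally/eqaddoP/(_ e e0) := dg.
  by apply: filterS => v; rewrite /rest /= !fctE /= opprD addrA.
have main : 'd g (f t) ((s - t)^-1 *: (f s - f t)) @[s --> within D t^'] --> 'd g (f t) l.
  by apply: (continuous_cvg _ (cdg l)).
rewrite -[X in _ --> X]addr0.
have r0 : (s - t)^-1 *: rest (f s - f t) @[s --> within D t^'] --> (0 : W).
  apply/cvgrPdist_le => e e0; have l1 : 0 < `|l| + 1 by rewrite ltr_pwDr.
  have e1 : 0 < e / (`|l| + 1) by exact: divr_gt0.
  near=> s; rewrite sub0r normrN normrZ.
  have h1 : `|rest (f s - f t)| <= e / (`|l| + 1) * `|f s - f t|.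
    by near: s; exact: finc (restP _ e1).
  have h2 : `|(s - t)^-1 *: (f s - f t)| <= `|l| + 1.
    near: s; have /cvgrPdist_le/(_ 1 ltr01) := fl; apply: filterS => s h.
    rewrite -lerBlDl; apply: le_trans h; rewrite distrC; apply: le_trans (lerB_dist _ _) _.
    by [].
  apply: le_trans (ler_wpM2l (normr_ge0 _) h1) _.
  rewrite mulrCA -normrZ; apply: le_trans (ler_wpM2l (ltW e1) h2) _.
  by rewrite divfK // gt_eqF.
apply: cvg_trans (cvgD main r0); apply: near_eq_cvg; near=> s.
by rewrite fctE /rest subrK linearZ -scalerDr [X in _ *: X = _]addrC subrK.
Unshelve. all: by end_near.
Qed.

Lemma quotients_within_id D (t : R) : quotients_within D id t --> (1 : R).
Proof.
have H : (1 : R) @[s --> within D t^'] --> (1 : R) by exact: cvg_cst.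
apply: cvg_trans H; apply: near_eq_cvg; near=> s.
rewrite [RHS]mulVf //.
by near: s; exact: near_within_dnbhs_sub.
Unshelve. all: by end_near. Qed.

Lemma quotients_within_differentiable {W : normedModType R} D (g : R -> W) (t : R) :
  differentiable g t -> quotients_within D g t --> 'D_1 g t.
Proof.
move=> dg; rewrite (deriveE _ dg).
exact: (quotients_within_comp (@quotients_within_id D t) dg).
Qed.

Lemma quotients_within_is_derive {W : normedModType R} (a b t : R) (f : R -> W) (l : W) :
  t \in `]a, b[%R -> quotients_within `[a, b] f t --> l -> is_derive t 1 f l.
Proof.
rewrite in_itv /= => /andP[ta tb] /cvgrPdist_lt fl.
suff H : h^-1 *: ((f \o shift t) (h *: 1) - f t) @[h --> (0 : R)^'] --> l.
  by split; [apply/cvg_ex; exists l|exact: cvg_lim H].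
apply/cvgrPdist_lt => e e0.
have : \forall s \near within `[a, b] t^', `|l - (s - t)^-1 *: (f s - f t)| < e.
  exact: fl.
rewrite !near_withinE => /nbhs_ballP[d /= d0 dP].
have tball (h : R) : `|h| < d -> ball t d (h + t).
  by move=> hd; rewrite -ball_normE /= opprD addrCA subrr addr0 normrN.
pose m := Num.min d (Num.min (t - a) (b - t)).
have m0 : 0 < m by rewrite !lt_min d0 !subr_gt0 ta.
near=> h => hn0; rewrite /= [h *: 1]mulr1.
have hd : `|h| < m by near: h; exact: (@nbhs0_lt R R).
move: hd; rewrite !lt_min => /and3P[hd ha hb].
have := dP _ (tball h hd); rewrite addrK; apply.
- by rewrite -subr_eq0 addrK.
- rewrite /= in_itv /=; move: ha hb.
  by rewrite !ltr_norml => /andP[ha1 _] /andP[_ hb2]; apply/andP; split; lra.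
Unshelve. all: by end_near. Qed.

End DerivWithin.

Lemma within_cvg (T U : topologicalType) (A : set T) (f : T -> U) x :
  {within A, continuous f} -> A x -> f y @[y --> within A (nbhs x)] --> f x.
Proof. by move=> /subspace_continuousP cf /cf. Qed.

Section ArcLength.
Context {R : realType} {n : nat} {M : riemannianManifold R n}.

Section OneArc.
Variables (gamma : R -> M) (h : M -> R).
Implicit Types (c : chart R n M).
Hypothesis arc : C1_arc gamma.
Hypothesis hC : forall c, atlas c -> C1on (cran c) (h \o cinv c).

Lemma arc_near_cdom c s : `[0, 1]%classic s -> cdom c (gamma s) ->
  \forall u \near within `[0, 1] (nbhs s), cdom c (gamma u).
Proof. by move=> Is cs; apply: (within_cvg arc.1 Is); exact: nbhs_cdom. Qed.

Lemma arc_quotients c s : atlas c -> `[0, 1]%classic s -> cdom c (gamma s) ->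
  quotients_within `[0, 1] (h \o gamma) s -->
  (deriv_within `[0, 1] (cfun c \o gamma) s *m
     gradient_in c h (cfun c (gamma s))) 0 0.
Proof.
move=> ac Is cs; have cz := cran_cfun cs.
have /= [dc _] := arc.2 c ac.
have dq := derivable_withinP (dc s (conj Is cs)).
have dh := C1on_differentiable (open_cran c) (hC ac) cz.
apply: (near_eq_quotients_within Is); last first.
  have <- : 'd (h \o cinv c) (cfun c (gamma s)) (deriv_within `[0, 1] (cfun c \o gamma) s) =
      (deriv_within `[0, 1] (cfun c \o gamma) s *m
        gradient_in c h (cfun c (gamma s))) 0 0.
    rewrite -deriveE // (derive_partial _ (open_cran c) (hC ac) cz) mxE.
    by apply: eq_bigr => i _; rewrite [gradient_in _ _ _ _ _]mxE.
  exact: quotients_within_comp dq dh.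
by apply: filterS (arc_near_cdom Is cs) => u cu; rewrite /= cfunK.
Qed.

Let slope s := (velocity gamma s *m differential h (gamma s)) 0 0.

Lemma arc_slope s : `[0, 1]%classic s ->
  quotients_within `[0, 1] (h \o gamma) s --> slope s.
Proof.
by move=> Is; apply: arc_quotients => //; [exact: chart_at_atlas|exact: chart_at_dom].
Qed.

(** Both sides are limits of the same quotients of [h \o gamma], so uniqueness of the limit gives
    independence of the chart without any Jacobian. *)
Lemma slope_in_chart c s : atlas c -> `[0, 1]%classic s -> cdom c (gamma s) ->
  slope s = (deriv_within `[0, 1] (cfun c \o gamma) s *m
     gradient_in c h (cfun c (gamma s))) 0 0.
Proof.
move=> ac Is cs.
rewrite -(deriv_withinE ltr01 Is (arc_quotients ac Is cs)).
by rewrite (deriv_withinE ltr01 Is (arc_slope Is)).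
Qed.

(** The components of [velocity] may jump with the preferred chart; the slope does not, since near
    [s] it can be computed in the single chart at [gamma s]. *)
Lemma continuous_slope : {within `[0, 1], continuous slope}.
Proof.
apply/subspace_continuousP => s Is.
pose c := chart_at (gamma s); have ac : atlas c by exact: chart_at_atlas.
have cs : cdom c (gamma s) by exact: chart_at_dom.
pose g u := (deriv_within `[0, 1] (cfun c \o gamma) u *m
     gradient_in c h (cfun c (gamma u))) 0 0.
have gs : g u @[u --> within `[0, 1] (nbhs s)] --> g s.
  apply: cvg_entry; apply: cvg_mulmx.
    have /= [_ cD] := arc.2 c ac.
    have := within_cvg cD (conj Is cs).
    apply: cvg_trans => P /=; rewrite !nbhs_simpl /= /within /=.
    have := arc_near_cdom Is cs; rewrite near_withinE; apply: filterS2 => u H1 H2 Iu.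
    by apply: H2; split => //; exact: H1.
  apply: cvg_mx => i j; under eq_fun do rewrite mxE; rewrite mxE.
  have ci := @C1on_cts_partial _ _ _ _ _ i (hC ac) (cran_cfun cs).
  exact: (cvg_comp _ _ (cvg_comp _ _ (within_cvg arc.1 Is) (continuous_cfun cs)) ci).
have e : g s = slope s by rewrite (slope_in_chart ac).
suff H : slope u @[u --> within `[0, 1] (nbhs s)] --> g s by rewrite e in H.
apply: cvg_trans gs; apply: near_eq_cvg.
rewrite near_withinE; have := arc_near_cdom Is cs; rewrite near_withinE.
by apply: filterS => u H Iu; rewrite (slope_in_chart ac Iu (H Iu)).
Qed.

(** The increment of [h / C] along the arc is the integral of its slope, by the fundamental theorem
    of calculus, and that slope is bounded by the speed. *)
Lemma arc_length_ge C : 0 < C ->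
  (forall (y : M) (v : tangent y), `|(v *m differential h y) 0 0| <=
    C * Num.sqrt ((v *m Defs.metric y *m v^T) 0 0)) ->
  ((`|h (gamma 1) - h (gamma 0)| / C)%:E <= arc_length gamma)%E.
Proof.
move=> C0 hb.
pose F s : R := C^-1 * h (gamma s).
have Fq s : `[0, 1]%classic s -> quotients_within `[0, 1] F s --> C^-1 * slope s.
  move=> Is; have := cvgMl_tmp (arc_slope Is : _ --> slope s).
  rewrite /quotients_within (_ : (fun u => (u - s)^-1 *: (F u - F s)) =
    (fun u => C^-1 * ((u - s)^-1 *: ((h \o gamma) u - (h \o gamma) s)))).
    by apply; exact: arc_slope.
  by apply/funext => u; rewrite /F -mulrBr [LHS]mulrCA.
have cF : {within `[0, 1], continuous F}.
  by apply/subspace_continuousP => s Is; exact: quotients_within_continuous (Fq s Is).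
have cs : {within `[0, 1], continuous (fun s => C^-1 * slope s)}.
  apply/subspace_continuousP => s Is; apply: cvgMl_tmp.
  exact: (within_cvg continuous_slope Is).
have Fd (s : R) : s \in `]0, 1[%R -> is_derive s 1 F (C^-1 * slope s).
  move=> sI; apply: (quotients_within_is_derive sI); apply: Fq.
  exact: subset_itv_oo_cc sI.
have F01 : derivable_oo_LRcontinuous F 0 1.
  have [_ c0 c1] := (continuous_within_itvP F ltr01).1 cF.
  by split => // s /Fd[].
have ftc := continuous_FTC2 ltr01 cs F01
  (fun s sI => etrans (derive1E F s) (derive_val (is_derive := Fd s sI))).
have i01 : lebesgue_measure.-integrable `[0%R, 1%R] (EFin \o (fun s => C^-1 * slope s)).
  by apply: continuous_compact_integrable => //; exact: segment_compact.
have := le_abse_integral lebesgue_measure (measurable_itv `[0%R, 1%R]) (measurable_int _ i01).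
rewrite [X in (`|X| <= _)%E]ftc -EFinB abse_EFin /F -mulrBr normrM normfV (gtr0_norm C0) mulrC.
move=> H; apply: le_trans H _; apply: ge0_le_integral_nonmeas => s Is.
  by rewrite abse_ge0.
rewrite /= lee_fin normrM normfV (gtr0_norm C0) ler_pdivrMl //.
exact: hb.
Qed.

End OneArc.

(** Leaving [U] costs the bump a drop of [e], so every curve from outside [U] to [x] has length at
    least [e / C]. Half of this is taken as radius because the distance is only assumed [<=] the
    radius. *)
Lemma rdist_nbhs (x : M) (U : set M) : nbhs x U ->
  exists2 r : R, 0 < r & forall y, (rdist y x <= r%:E)%E -> U y.
Proof.
move=> Ux; have [ac cx] := (chart_at_atlas x, chart_at_dom x).
have [r r0 rc] := chart_cball cx.
pose h := bump (chart_at x) x r.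
have hC2 c' : atlas c' -> C1on (cran c') (h \o cinv c').
  by move=> ac'; have [] := bump_C2 ac r0 rc ac'.
have [e e0 hU] := bump_strict_max cx r0 Ux.
have [C0 C00 hb0] := bump_differential_bound ac r0 rc.
(* [C0] may be zero, whereas the lengths are compared after division by [C]. *)
pose C := C0 + 1; have Cgt0 : 0 < C by rewrite ltr_pwDr.
have hb (y : M) (v : tangent y) : `|(v *m differential h y) 0 0| <=
    C * Num.sqrt ((v *m Defs.metric y *m v^T) 0 0).
  by apply: le_trans (hb0 y v) _; rewrite ler_wpM2r ?sqrtr_ge0 // lerDl.
(* Induction on the number of arcs, with the triangle inequality for the values of [h] at the
   junctions. *)
have curve y z l : curve_length y z l -> ((`|h z - h y| / C)%:E <= l)%E.
  elim=> [p|gamma p l' arc _ IH]; first by rewrite subrr normr0 mul0r.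
  apply: le_trans (leeD (arc_length_ge arc hC2 Cgt0 hb) IH).
  rewrite -EFinD lee_fin -mulrDl ler_pM2r ?invr_gt0 //.
  by rewrite -(subrKA (h (gamma 1))) [leRHS]addrC ler_normD.
exists (e / C / 2); first by rewrite !divr_gt0.
move=> y yx; have [//|nU] := pselect (U y).
have : ((e / C)%:E <= rdist y x)%E.
  apply: le_ereal_inf_tmp => l /= /curve; apply: le_trans.
  rewrite lee_fin ler_pM2r ?invr_gt0 //; apply: le_trans (ler_norm _).
  by rewrite lerBrDl -lerBrDr; exact: hU.
move=> /le_trans/(_ yx); rewrite lee_fin.
have : 0 < e / C by exact: divr_gt0.
by lra.
Qed.

End ArcLength.

Section StraightLines.
Context {R : realType} {n : nat} {M : riemannianManifold R n}.

Section OneLine.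
Variables (c : chart R n M) (z0 z : 'rV[R]_n).
Hypothesis ac : atlas c.
Let v : 'rV[R]_n := z0 - z.
Let line (s : R) : 'rV[R]_n := z + s *: v.
Hypothesis line_cran : forall s, `[0, 1]%classic s -> cran c (line s).
Let gamma s := cinv c (line s).

Let is_diff_line (s : R) : is_derive s 1 line v.
Proof.
have d : is_derive s 1 (fun t : R => t *: v) v.
  suff H : h^-1 *:
      (((fun t : R => t *: v) \o shift s) (h *: 1) - s *: v) @[h --> (0 : R)^'] --> v.
    by split; [apply/cvg_ex; exists v|exact: cvg_lim H].
  have H : v @[h --> (0 : R)^'] --> v by exact: cvg_cst.
  apply: cvg_trans H; apply: near_eq_cvg; near=> h.
  rewrite /= [h *: 1]mulr1 scalerDl addrK scalerA mulVf ?scale1r //.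
  by near: h; exact: nbhs_dnbhs_neq.
have [d1 d2] := is_deriveD (is_derive_cst z s 1) d.
by split; [exact: d1|rewrite [LHS]d2 add0r].
Unshelve. all: by end_near. Qed.

Let differentiable_line (s : R) : differentiable line s.
Proof. by apply/derivable1_diffP; case: (is_diff_line s). Qed.

Let line_cts (s : R) : {for s, continuous line}.
Proof. exact: differentiable_continuous. Qed.

Let cfun_quotients c' s : atlas c' -> `[0, 1]%classic s -> cdom c' (gamma s) ->
  quotients_within `[0, 1] (cfun c' \o gamma) s --> 'D_v (transition c c') (line s).
Proof.
move=> ac' Is cs'.
have Us : overlap c c' (line s) by rewrite overlapE; split => //; exact: line_cran.
have dt := smooth_differentiable (atlas_smooth ac ac') Us.
have dc : differentiable (transition c c' \o line) s by exact: differentiable_comp.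
have := @quotients_within_differentiable _ _ `[0, 1] _ s dc.
rewrite (derive_compE _ (differentiable_line s) dt).
by rewrite (derive_val (is_derive := is_diff_line s)).
Qed.

Lemma line_C1_arc : C1_arc gamma.
Proof.
split.
  apply/subspace_continuousP => s Is.
  apply: (cvg_comp line (cinv c) _ (continuous_cinv (line_cran Is))).
  by apply: cvg_within_filter; exact: line_cts.
move=> c' ac' D; split=> [s [Is cs]|].
  by apply/cvg_ex; exists ('D_v (transition c c') (line s)); exact: cfun_quotients.
have DE s : D s -> deriv_within `[0, 1] (cfun c' \o gamma) s = 'D_v (transition c c') (line s).
  by move=> [Is cs]; exact: deriv_withinE ltr01 Is (cfun_quotients ac' Is cs).
apply/subspace_continuousP => s Ds; rewrite /from_subspace (DE s Ds).
have Us : overlap c c' (line s).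
  by case: Ds => Is cs; rewrite overlapE; split => //; exact: line_cran.
have cD := smooth_continuous (smooth_derive v (atlas_smooth ac ac')) Us.
have H : 'D_v (transition c c') (line u) @[u --> within D (nbhs s)] -->
    'D_v (transition c c') (line s).
  apply: (@cvg_within_filter _ _ _ (nbhs s) _ (nbhs ('D_v (transition c c') (line s)))).
  exact: (continuous_comp (@line_cts s) cD).
apply: cvg_trans H; apply: near_eq_cvg.
by rewrite near_withinE; apply: nearW => u Du; rewrite DE.
Qed.

(** In the preferred chart the velocity is [v] times a Jacobian, and the same Jacobian relates the
    two matrices of the metric. *)
Lemma line_speed s : `[0, 1]%classic s ->
  (velocity gamma s *m Defs.metric (gamma s) *m (velocity gamma s)^T) 0 0 =
  (v *m metric_in c (line s) *m v^T) 0 0.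
Proof.
move=> Is; have cz := line_cran Is; have cs : cdom c (gamma s) by exact: cdom_cinv.
have [ac' cs'] := (chart_at_atlas (gamma s), chart_at_dom (gamma s)).
have -> : velocity gamma s = v *m jac c (chart_at (gamma s)) (gamma s).
  rewrite /velocity (deriv_withinE ltr01 Is (cfun_quotients ac' Is cs')).
  by rewrite jacE // cinvK.
have := metric_in_cfun cs; rewrite cinvK // => ->.
move: (jac _ _ _) (Defs.metric _) => J g.
by rewrite trmx_mul !mulmxA.
Qed.

(** The quadratic form has [n^2] terms, each at most [G |v|^2], so the speed is at most
    [n * Num.sqrt G * |v|] on an interval of length 1. *)
Lemma line_length (G : R) : 0 <= G ->
  (forall s, `[0, 1]%classic s -> `|metric_in c (line s)| <= G) ->
  (arc_length gamma <= (n%:R * Num.sqrt G * `|v|)%:E)%E.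
Proof.
move=> G0 mG.
have i1 : (\int[lebesgue_measure]_(s in `[0%R, 1%R])
    cst (n%:R * Num.sqrt G * `|v|)%:E s = (n%:R * Num.sqrt G * `|v|)%:E)%E.
  by rewrite integral_cst //= lebesgue_measure_itv /= lte01 oppr0 adde0 mule1.
rewrite -[leRHS]i1; apply: ge0_le_integral_nonmeas => s Is.
  by rewrite lee_fin sqrtr_ge0.
rewrite /= lee_fin line_speed //.
have b0 : 0 <= n%:R * Num.sqrt G * `|v| by rewrite !mulr_ge0 // sqrtr_ge0.
rewrite -[leRHS]ger0_norm // -sqrtr_sqr ler_wsqrtr //.
have := mG s Is; move: (metric_in c (line s)) => g gG.
rewrite mxE; apply: (@le_trans _ _ (\sum_(j < n) \sum_(i < n) (G * `|v| ^+ 2))).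
  apply: ler_sum => j _; rewrite mxE mulr_suml; apply: ler_sum => i _.
  rewrite [v^T _ _]mxE; apply: le_trans (ler_norm _) _; rewrite !normrM expr2 mulrAC mulrC.
  apply: ler_pM; rewrite ?mulr_ge0 //; first by exact: le_trans (ler_entry_norm _ _ _) gG.
  by apply: ler_pM => //; exact: ler_entry_norm.
rewrite !sumr_const card_ord -mulrnA -[leLHS]mulr_natl natrM.
by rewrite !exprMn sqr_sqrtr // -expr2 mulrA.
Qed.

End OneLine.

Lemma nbhs_rdist (x : M) (r : R) : 0 < r ->
  \forall y \near x, (rdist y x < r%:E)%E.
Proof.
move=> r0; have [ac cx] := (chart_at_atlas x, chart_at_dom x).
set c := chart_at x in ac cx; pose z0 := cfun c x.
have cz0 : cran c z0 by exact: cran_cfun.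
pose G := `|metric_in c z0| + 1.
have G0 : 0 < G by rewrite ltr_pwDr.
have nG : \forall z \near z0, cran c z /\ `|metric_in c z| <= G.
  near=> z; split; near: z; first exact: nbhs_cran.
  have /cvgrPdist_le/(_ 1 ltr01) := smooth_continuous (smooth_metric_in ac) cz0.
  apply: filterS => z zg; rewrite /G -lerBlDl; apply: le_trans zg.
  by rewrite distrC; exact: lerB_dist.
have /nbhs_ballP[d /= d0 dP] := nG.
(* [k] bounds the length per unit of chart distance; the added 1 keeps it positive for the division
   [r / k]. *)
pose k := n%:R * Num.sqrt G + 1.
have k0 : 0 < k by rewrite ltr_pwDr // mulr_ge0 // sqrtr_ge0.
pose e := Num.min d (r / k).
have e0 : 0 < e by rewrite lt_min d0 divr_gt0.
have nx : \forall y \near x, cdom c y /\ ball z0 e (cfun c y).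
  near=> y; split; near: y; first exact: nbhs_cdom.
  by apply: (continuous_cfun cx); exact: nbhsx_ballx.
apply: filterS nx => y [cy]; rewrite -ball_normE /= => ze.
set z := cfun c y in ze.
have lineP (s : R) : `[0, 1]%classic s -> ball z0 d (z + s *: (z0 - z)).
  rewrite /= in_itv /= => /andP[s0 s1]; rewrite -ball_normE /=.
  rewrite opprD addrA -{1}[z0 - z]scale1r -scalerBl normrZ.
  apply: le_lt_trans (_ : `|z0 - z| < d); last by apply: lt_le_trans ze _; rewrite ge_min lexx.
  rewrite ler_piMl // ger0_norm ?subr_ge0 //; lra.
have lc (s : R) (Is : `[0, 1]%classic s) := (dP _ (lineP s Is)).1.
have lG (s : R) (Is : `[0, 1]%classic s) := (dP _ (lineP s Is)).2.
have len := line_length ac lc (ltW G0) lG.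
have cur := curve_length_cons (line_C1_arc ac lc) (@curve_length_nil _ _ _ _).
rewrite scale0r addr0 scale1r subrKC in cur.
rewrite (cfunK cy : cinv c z = y) (cfunK cx : cinv c z0 = x) adde0 in cur.
apply: le_lt_trans (ereal_inf_lbound cur) _.
apply: le_lt_trans len _; rewrite lte_fin.
apply: (@le_lt_trans _ _ (k * `|z0 - z|)); first by rewrite ler_wpM2r // lerDl.
rewrite -ltr_pdivlMl // mulrC; apply: lt_le_trans ze _.
by rewrite ge_min lexx orbT.
Unshelve. all: by end_near. Qed.

Lemma curve_length_cat (x y z : M) l l' :
  curve_length x y l -> curve_length y z l' -> curve_length x z (l + l')%E.
Proof.
move=> xy; elim: xy l' => [p|gamma p l1 arc _ IH] l' yz; first by rewrite add0e.
by rewrite -addeA; apply: curve_length_cons arc _; exact: IH.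
Qed.

(** Strict bounds on the infima provide actual curves, which are then concatenated. *)
Lemma rdist_lt_trans (x y z : M) (a b : R) :
  (rdist x y < a%:E)%E -> (rdist y z < b%:E)%E -> (rdist x z < (a + b)%:E)%E.
Proof.
move=> /ereal_inf_lt[l /= xy la] /ereal_inf_lt[l' /= yz lb].
apply: le_lt_trans (ereal_inf_lbound (curve_length_cat xy yz)) _.
by rewrite EFinD; exact: lteD.
Qed.

Lemma rdist_refl_le (x : M) : (rdist x x <= 0)%E.
Proof. by apply: ereal_inf_lbound; exact: curve_length_nil. Qed.

End StraightLines.

(** * Upper semicontinuous envelope and test functions *)

(** Without a maximum, the sets [B p] of points of [K] with larger value form a filter base.
    Semicontinuity gives local bounds [g < g q], and compactness as a covering property makes them
    uniform along the filter: some [i] in [K] has [g < g i] on all of [K], hence at [i]. *)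
Lemma usc_compact_max (R : realType) (X : topologicalType) (K : set X) (g : X -> R) :
  compact K -> K !=set0 ->
  (forall p, K p -> forall a, g p < a -> \forall q \near within K (nbhs p), g q < a) ->
  exists2 p, K p & forall q, K q -> g q <= g p.
Proof.
move=> /compact_near_coveringP cK [k0 Kk0] usc; apply: contrapT => nomax.
have next p : K p -> exists2 q, K q & g p < g q.
  move=> Kp; apply: contrapT => nq; apply: nomax; exists p => // q Kq.
  by rewrite leNgt; apply/negP => pq; apply: nq; exists q.
pose B p := [set q | K q /\ g p < g q].
pose F := filter_from K B.
have FF : Filter F.
  apply: filter_from_filter; first by exists k0.
  move=> p q Kp Kq; have [pq|qp] := leP (g p) (g q).
    by exists q => // s [Ks qs]; split; split => //; exact: le_lt_trans qs.
  by exists p => // s [Ks ps]; split; split => //; exact: lt_trans ps.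
have [i Ki iP] : exists2 i, K i & forall p, K p -> g p < g i.
  have : \forall i \near F, K `<=` [set p | K p -> g p < g i].
    apply: (cK X F (fun i p => K p -> g p < g i)) => p Kp.
    have [q Kq pq] := next p Kp.
    exists ([set p' | K p' -> g p' < g q], B q) => /=.
      split; last by exists q.
      by have := usc p Kp _ pq; rewrite near_withinE.
    by move=> [p' i] /= [p'q [Ki qi]] Kp'; exact: lt_trans (p'q Kp') qi.
  move=> [p Kp pP]; have [i Ki pi] := next p Kp.
  by exists i => // p' Kp'; exact: pP.
by have := iP i Ki; rewrite ltxx.
Qed.

Section Envelope.
Context {R : realType} {n : nat} {M : riemannianManifold R n}.
Variables (T : R) (Omega : set M) (w : R -> M -> \bar R).
Local Open Scope ereal_scope.

Let near_sup t x (r : R) := ereal_sup [set w q.1 q.2 | q in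
  [set q | [/\ domain T Omega q, (`|q.1 - t| <= r)%R & rdist q.2 x <= r%:E]]].

(** The supremum is nondecreasing in the radius, so its limit at [0^+] is an infimum. *)
Lemma usc_envelopeE t x :
  usc_envelope T Omega w t x = ereal_inf [set near_sup t x r | r in `]0%R, +oo[].
Proof.
apply: cvg_lim => //.
apply: (@nondecreasing_at_right_cvge _ (near_sup t x) 0%R +oo%O) => // r s _ _ rs.
apply: ereal_sup_le => _ [q [qD qt qx] <-]; exists q => //; split => //.
  exact: le_trans rs.
by apply: le_trans qx _; rewrite lee_fin.
Qed.

Lemma usc_envelope_ge t x : domain T Omega (t, x) -> w t x <= usc_envelope T Omega w t x.
Proof.
move=> D; rewrite usc_envelopeE; apply: le_ereal_inf_tmp => _ [r /= r0 <-].
rewrite in_itv /= andbT in r0.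
apply: ereal_sup_ubound; exists (t, x) => //; split => //=.
  by rewrite subrr normr0 ltW.
by apply: le_trans (rdist_refl_le x) _; rewrite lee_fin ltW.
Qed.

Lemma usc_envelope_gt t x b (r : R) : b < usc_envelope T Omega w t x -> (0 < r)%R ->
  exists q, [/\ domain T Omega q, (`|q.1 - t| <= r)%R, rdist q.2 x <= r%:E & b < w q.1 q.2].
Proof.
rewrite usc_envelopeE => bw r0.
have : b < near_sup t x r.
  by apply: lt_le_trans bw _; apply: ereal_inf_lbound; exists r => //=; rewrite in_itv /= r0.
by move=> /ereal_sup_gt[_ [q [qD qt qx] <-] bq]; exists q.
Qed.

(** If the supremum at radius [r] around [(t, x)] is below [a], it also controls smaller
    neighbourhoods of points within [r / 2]. Radius [r / 4] turns the [<=] of the envelope into the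
    strict bound [r / 2] required by [rdist_lt_trans]. *)
Lemma usc_envelope_usc : usc_on_domain T Omega (usc_envelope T Omega w).
Proof.
move=> t x _ a; rewrite usc_envelopeE => /ereal_inf_lt[_ [r /= + <-] ra].
rewrite in_itv /= andbT => r0.
have r2 : (0 < r / 2)%R by rewrite divr_gt0.
rewrite near_withinE; near=> q => qD.
apply: le_lt_trans _ ra; rewrite usc_envelopeE.
apply: (@le_trans _ _ (near_sup q.1 q.2 (r / 4))).
  by apply: ereal_inf_lbound; exists (r / 4)%R => //=; rewrite in_itv /= divr_gt0.
apply: ereal_sup_le => _ [p [pD pt px] <-]; exists p => //; split => //.
  have : (`|q.1 - t| < r / 2)%R.
    near: q; exists (ball t (r / 2), setT) => /=.
      by split; [exact: nbhsx_ballx|exact: filterT].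
    by move=> q [/=]; rewrite -ball_normE /= distrC.
  have := ler_normD (p.1 - q.1)%R (q.1 - t)%R; rewrite subrKA; lra.
have qx : rdist q.2 x < (r / 2)%:E.
  near: q; exists (setT, [set y | rdist y x < (r / 2)%:E]) => /=.
    by split; [exact: filterT|exact: nbhs_rdist].
  by move=> q [].
have px' : rdist p.2 q.2 < (r / 2)%:E.
  by apply: le_lt_trans px _; rewrite lte_fin; lra.
have := rdist_lt_trans px' qx; rewrite -splitr; exact: ltW.
Unshelve. all: by end_near. Qed.

End Envelope.

Lemma within_cvg_continuous (T U : topologicalType) (A : set T) (f : T -> U) :
  (forall x, A x -> f y @[y --> within A (nbhs x)] --> f x) -> {within A, continuous f}.
Proof. by move=> cf; apply/subspace_continuousP. Qed.

Lemma eq_within_continuous (T U : topologicalType) (A : set T) (f g : T -> U) :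
  (forall x, A x -> f x = g x) -> {within A, continuous f} -> {within A, continuous g}.
Proof.
by move=> fg; apply: subspace_eq_continuous => x /set_mem; exact: fg.
Qed.

Lemma within_continuousD (R : realType) (T : topologicalType) (A : set T) (f g : T -> R) :
  {within A, continuous f} -> {within A, continuous g} ->
  {within A, continuous (fun x => f x + g x)}.
Proof.
move=> cf cg; apply: within_cvg_continuous => x Ax.
by apply: cvgD; exact: within_cvg.
Qed.

Lemma within_slice_continuous (S X W : topologicalType) (A : set S) (V : set X)
    (G : S * X -> W) s y :
  open V -> {within A `*` V, continuous G} -> A s -> V y ->
  {for y, continuous (fun z => G (s, z))}.
Proof.
move=> oV cG As Vy P PG.
have : \forall q \near within (A `*` V) (nbhs (s, y)), P (G q).
  exact: (within_cvg cG (conj As Vy : (A `*` V) (s, y)) PG).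
rewrite near_withinE => -[[P1 P2] /= [P1s P2y] sub].
have Vn : nbhs y V by exact: open_nbhs_nbhs.
apply: filterS2 Vn P2y => z Vz P2z.
by apply: (sub (s, z)) (conj As Vz); split => //=; exact: nbhs_singleton.
Qed.

Lemma quotients_withinD (R : realType) (W : normedModType R) (D : set R)
    (f g : R -> W) (t : R) (l m : W) :
  quotients_within D f t --> l -> quotients_within D g t --> m ->
  quotients_within D (fun s => f s + g s) t --> l + m.
Proof.
move=> fl gm; rewrite /quotients_within.
rewrite (_ : (fun s => _) = (fun s => (s - t)^-1 *: (f s - f t) + (s - t)^-1 *: (g s - g t))).
  exact: cvgD.
by apply/funext => s; rewrite -scalerDr opprD addrACA.
Qed.

Section C2Sums.
Context {R : realType} {n : nat}.
Variables (V : set 'rV[R]_n) (f g : 'rV[R]_n -> R).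
Hypotheses (oV : open V) (fV : C2on V f) (gV : C2on V g).

Lemma C2onD : C2on V (fun z => f z + g z).
Proof.
split=> [|i]; first exact: C1onD oV fV.1 gV.1.
apply: eq_C1on (C1onD oV (fV.2 i) (gV.2 i)) => // z Vz.
by rewrite (@partialD _ _ V) //; [exact: fV.1|exact: gV.1].
Qed.

Lemma partial_add i z : V z ->
  partial i (fun z => f z + g z) z = partial i f z + partial i g z.
Proof. by move=> Vz; exact: (@partialD _ _ V f g z i fV.1 gV.1 Vz). Qed.

Lemma partial2_add i j z : V z -> partial i (partial j (fun z => f z + g z)) z =
  partial i (partial j f) z + partial i (partial j g) z.
Proof.
move=> Vz; rewrite -(@partialD _ _ V _ _ z i (fV.2 j) (gV.2 j) Vz).
by apply: eq_partial oV Vz _ => u Vu; exact: partial_add.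
Qed.

End C2Sums.

Lemma partial_cst_fun (R : realType) (n : nat) (a : R) (i : 'I_n) :
  partial i (fun _ : 'rV[R]_n => a) = fun _ => 0.
Proof. by apply/funext => z; exact: derive_cst. Qed.

Lemma C2on_cst (R : realType) (n : nat) (V : set 'rV[R]_n) (a : R) :
  C2on V (fun _ => a).
Proof.
by split=> [|i]; [exact: C1on_cst|rewrite partial_cst_fun; exact: C1on_cst].
Qed.

Lemma C2onZ (R : realType) (n : nat) (V : set 'rV[R]_n) (f : 'rV[R]_n -> R) (a : R) :
  open V -> C2on V f -> C2on V (fun z => a * f z).
Proof.
move=> oV [fV ffV]; split=> [|i]; first exact: C1onM oV (@C1on_cst _ _ V a) fV.
apply: eq_C1on (C1onM oV (@C1on_cst _ _ V a) (ffV i)) => // z Vz.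
have := @partialM _ _ V _ _ z i (@C1on_cst _ _ V a) fV Vz.
have -> : partial i (cst a : 'rV[R]_n -> R) z = 0 by exact: derive_cst.
by rewrite mulr0 addr0 => ->.
Qed.

(** * The class C^{1,2}: slices, sums, functions of time or of space only, joint continuity *)

Section C12Functions.
Context {R : realType} {n : nat} {M : riemannianManifold R n}.
Variable T : R.
Hypothesis T0 : 0 < T.
Implicit Types (phi psi : R -> M -> R) (c : chart R n M).

(** Joint continuity on [[0, T]] times an open set restricts to each fixed time, so the calculus of
    [C2on] applies to [phi s]. *)
Lemma C12_slice phi c s : C12 T phi -> atlas c -> `[0, T]%classic s ->
  C2on (cran c) (phi s \o cinv c).
Proof.
move=> ph ac Is; have [_ _ p1 p2] := ph c ac; split=> [z cz i|j z cz i].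
  have [d cd] := p1 i; split; first exact: (d s z (conj Is cz)).
  exact: (within_slice_continuous (open_cran c) cd Is cz).
have [d cd] := p2 i j; split; first exact: (d s z (conj Is cz)).
exact: (within_slice_continuous (open_cran c) cd Is cz).
Qed.

Lemma C12_time_quotients phi s x : C12 T phi -> `[0, T]%classic s ->
  quotients_within `[0, T] (phi ^~ x) s --> time_derivative T phi s x.
Proof.
move=> ph Is; have [ac cx] := (chart_at_atlas x, chart_at_dom x).
have [_ [d _] _ _] := ph _ ac.
have := derivable_withinP (d s (cfun (chart_at x) x) (conj Is (cran_cfun cx))).
by rewrite (_ : (fun t => _) = phi ^~ x) //; apply/funext => t; rewrite cfunK.
Qed.

Lemma C12D phi psi : C12 T phi -> C12 T psi -> C12 T (fun s x => phi s x + psi s x).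
Proof.
move=> ph ps c ac; have [p0 [pt cpt] p1 p2] := ph c ac.
have [q0 [qt cqt] q1 q2] := ps c ac.
have pC s Is := @C12_slice phi c s ph ac Is.
have qC s Is := @C12_slice psi c s ps ac Is.
have oV := open_cran c.
split.
- exact: within_continuousD.
- have H s z : (`[0, T] `*` cran c) (s, z) ->
      quotients_within `[0, T] (fun s => phi s (cinv c z) + psi s (cinv c z)) s -->
      deriv_within `[0, T] (fun s => phi s (cinv c z)) s +
      deriv_within `[0, T] (fun s => psi s (cinv c z)) s.
    by move=> D; apply: quotients_withinD; apply: derivable_withinP; [exact: pt|exact: qt].
  split=> [s z D|]; first by apply/cvg_ex; eexists; exact: H D.
  apply: eq_within_continuous (within_continuousD cpt cqt) => -[s z] [/= Is cz].
  by rewrite (deriv_withinE T0 Is (H s z (conj Is cz))).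
- move=> i; have [_ cp] := p1 i; have [_ cq] := q1 i; split=> [s z [/= Is cz]|].
    exact: (C1on_derivable (C2onD oV (pC s Is) (qC s Is)).1 cz).
  apply: eq_within_continuous (within_continuousD cp cq) => -[s z] [/= Is cz].
  by rewrite (partial_add (pC s Is) (qC s Is)).
- move=> i j; have [_ cp] := p2 i j; have [_ cq] := q2 i j; split=> [s z [/= Is cz]|].
    exact: (C1on_derivable ((C2onD oV (pC s Is) (qC s Is)).2 j) cz).
  apply: eq_within_continuous (within_continuousD cp cq) => -[s z] [/= Is cz].
  by rewrite (partial2_add oV (pC s Is) (qC s Is)).
Qed.

Lemma C12_time (a da : R -> R) : (forall s : R, is_derive s 1 a (da s)) ->
  continuous da -> C12 T (fun s (_ : M) => a s).
Proof.
move=> ada cda c ac.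
have aq s : quotients_within `[0, T] a s --> da s.
  have [d <-] := ada s; apply: quotients_within_differentiable.
  exact/derivable1_diffP.
have c0 : {within `[0, T] `*` cran c, continuous (fun _ : R * 'rV[R]_n => 0 : R)}.
  by apply: continuous_subspaceT => q; exact: cst_continuous.
split.
- apply: continuous_subspaceT => q; apply: continuous_comp; first exact: cvg_fst.
  apply: differentiable_continuous; apply/derivable1_diffP.
  by case: (ada q.1).
- split=> [s z _|]; first by apply/cvg_ex; exists (da s); exact: aq.
  have H : {within `[0, T] `*` cran c, continuous (fun q : R * 'rV[R]_n => da q.1)}.
    by apply: continuous_subspaceT => q; apply: continuous_comp; [exact: cvg_fst|exact: cda].
  apply: eq_within_continuous H => -[s z] [/= Is cz].
  by rewrite (deriv_withinE T0 Is (aq s)).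
- move=> i; split=> [s z _|]; first exact: derivable_cst.
  by apply: eq_within_continuous c0 => -[s z] _ /=; rewrite partial_cst_fun.
- move=> i j; split=> [s z _|]; first by rewrite partial_cst_fun; exact: derivable_cst.
  by apply: eq_within_continuous c0 => -[s z] _ /=; rewrite !partial_cst_fun.
Qed.

Lemma C12_space (h : M -> R) : (forall c, atlas c -> C2on (cran c) (h \o cinv c)) ->
  C12 T (fun _ => h).
Proof.
move=> hC c ac; have [hV hhV] := hC c ac; have oV := open_cran c.
have cq (k : R) (s : R) : quotients_within `[0, T] (fun _ => k) s --> (0 : R).
  rewrite /quotients_within (_ : (fun u => _) = fun _ => 0); first exact: cvg_cst.
  by apply/funext => u; rewrite subrr scaler0.
have comp (G : 'rV[R]_n -> R) : (forall z, cran c z -> {for z, continuous G}) ->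
    {within `[0, T] `*` cran c, continuous (fun q : R * 'rV[R]_n => G q.2)}.
  move=> cG; apply: continuous_in_subspaceT => -[s z] /set_mem[/= _ cz].
  by apply: continuous_comp; [exact: cvg_snd|exact: cG].
split.
- by apply: (comp (h \o cinv c)) => z cz; exact: C1on_continuous oV hV cz.
- split=> [s z _|]; first by apply/cvg_ex; exists 0; exact: cq.
  have H : {within `[0, T] `*` cran c, continuous (fun q : R * 'rV[R]_n => 0 : R)}.
    by apply: continuous_subspaceT => q; exact: cst_continuous.
  apply: eq_within_continuous H => -[s z] [/= Is cz].
  by rewrite (deriv_withinE T0 Is (cq _ s)).
- move=> i; split=> [s z [_ cz]|]; first exact: (C1on_derivable hV cz).
  by apply: (comp (partial i (h \o cinv c))) => z cz; exact: C1on_cts_partial hV cz.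
- move=> i j; split=> [s z [_ cz]|]; first exact: (C1on_derivable (hhV j) cz).
  by apply: (comp (partial i (partial j (h \o cinv c)))) => z cz;
    exact: C1on_cts_partial (hhV j) cz.
Qed.

Lemma time_derivativeD phi psi s x : C12 T phi -> C12 T psi -> `[0, T]%classic s ->
  time_derivative T (fun s x => phi s x + psi s x) s x =
  time_derivative T phi s x + time_derivative T psi s x.
Proof.
move=> ph ps Is; apply: (deriv_withinE T0 Is).
by apply: quotients_withinD;
  [exact: (C12_time_quotients ph Is)|exact: (C12_time_quotients ps Is)].
Qed.

Lemma C12_continuous phi s x : C12 T phi -> `[0, T]%classic s ->
  phi q.1 q.2 @[q --> within (`[0, T] `*` setT) (nbhs (s, x))] --> phi s x.
Proof.
move=> ph Is; pose c := chart_at x.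
have [ac cx] : atlas c /\ cdom c x by split; [exact: chart_at_atlas|exact: chart_at_dom].
have [p0 _ _ _] := ph _ ac.
have H := within_cvg p0 (conj Is (cran_cfun cx) : (`[0, T] `*` cran c) (s, cfun c x)).
rewrite /= cfunK // in H.
have K : (q.1, cfun c q.2) @[q --> within (`[0, T] `*` setT) (nbhs (s, x))] -->
    within (`[0, T] `*` cran c) (nbhs (s, cfun c x)).
  move=> P PH.
  have : \forall q \near within (`[0, T] `*` cran c) (nbhs (s, cfun c x)), P q by exact: PH.
  rewrite near_withinE => -[[P1 P2] /= [P1s P2x] sub].
  suff : \forall q \near within (`[0, T] `*` setT) (nbhs (s, x)), P (q.1, cfun c q.2) by [].
  rewrite near_withinE; exists (P1, cdom c `&` cfun c @^-1` P2) => /=.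
    split => //; apply: filterI; first exact: nbhs_cdom.
    exact: (continuous_cfun cx).
  move=> [u y] /= [P1u [cy P2y]] [/= Iu _].
  by apply: (sub (u, cfun c y)) => //; split => //; exact: cran_cfun.
have := cvg_comp _ _ K H; apply: cvg_trans; apply: near_eq_cvg.
rewrite near_withinE; exists (setT, cdom c) => /=.
  by split; [exact: filterT|exact: nbhs_cdom].
by move=> [u y] /= [_ cy] _; rewrite cfunK.
Qed.

End C12Functions.

Section PerturbedJets.
Context {R : realType} {n : nat} {M : riemannianManifold R n}.
Variables (c : chart R n M) (f h : M -> R) (a e : R).
Hypotheses (fC : C2on (cran c) (f \o cinv c)) (hC : C2on (cran c) (h \o cinv c)).

Let oV : open (cran c). Proof. exact: open_cran. Qed.

Let eC : C2on (cran c) (fun z => e * h (cinv c z)).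
Proof. exact: C2onZ. Qed.

Let aeC : C2on (cran c) (fun z => a + e * h (cinv c z)).
Proof. exact: C2onD (@C2on_cst _ _ _ a) eC. Qed.

Lemma perturbed_C2 : C2on (cran c) ((fun x => f x + (a + e * h x)) \o cinv c).
Proof. exact: C2onD fC aeC. Qed.

Let partial_e (g : 'rV[R]_n -> R) i z : C1on (cran c) g -> cran c z ->
  partial i (fun z => e * g z) z = e * partial i g z.
Proof.
move=> gC cz; have := @partialM _ _ (cran c) _ _ z i (@C1on_cst _ _ _ e) gC cz.
have -> : partial i (cst e : 'rV[R]_n -> R) z = 0 by exact: derive_cst.
by rewrite mulr0 addr0.
Qed.

Let partial_perturbed i z : cran c z ->
  partial i ((fun x => f x + (a + e * h x)) \o cinv c) z =
  partial i (f \o cinv c) z + e * partial i (h \o cinv c) z.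
Proof.
move=> cz; rewrite -(partial_e i hC.1 cz).
have := partial_add fC aeC i cz; rewrite [in RHS](partial_add (@C2on_cst _ _ _ a) eC i cz).
by rewrite partial_cst_fun add0r.
Qed.

Lemma gradient_in_perturbed z : cran c z ->
  gradient_in c (fun x => f x + (a + e * h x)) z =
  gradient_in c f z + e *: gradient_in c h z.
Proof. by move=> cz; apply/colP => i; rewrite !mxE partial_perturbed. Qed.

Lemma hessian_in_perturbed z : cran c z ->
  hessian_in c (fun x => f x + (a + e * h x)) z =
  hessian_in c f z + e *: hessian_in c h z.
Proof.
move=> cz; apply/matrixP => i j; rewrite !mxE.
have -> : partial i (partial j ((fun x => f x + (a + e * h x)) \o cinv c)) z =
    partial i (partial j (f \o cinv c)) z + e * partial i (partial j (h \o cinv c)) z.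
  rewrite -(partial_e i (hC.2 j) cz).
  have -> : partial i (partial j ((fun x => f x + (a + e * h x)) \o cinv c)) z =
      partial i (fun z => partial j (f \o cinv c) z + e * partial j (h \o cinv c) z) z.
    by apply: eq_partial oV cz _ => u cu; exact: partial_perturbed.
  have eD : C1on (cran c) (fun z => e * partial j (h \o cinv c) z).
    exact: C1onM oV (@C1on_cst _ _ _ e) (hC.2 j).
  exact: (@partialD _ _ (cran c) _ _ z i (fC.2 j) eD cz).
rewrite mulrBr mulr_sumr [RHS]addrACA; congr (_ + _).
rewrite -opprD -big_split; congr (- _); apply: eq_bigr => k _ /=.
by rewrite partial_perturbed // mulrDr; congr (_ + _); rewrite mulrCA.
Qed.

End PerturbedJets.

(** * Joint continuity of the perturbed jets and of [F] along them *)

Section JetContinuity.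
Context {R : realType} {n : nat} {M : riemannianManifold R n}.
Variables (T : R) (F : R -> forall x : M, R -> cotangent x -> bilinear_form x -> R).
Variables (phi : R -> M -> R) (h : M -> R) (t : R) (x : M) (c : chart R n M).
Hypotheses (T0 : 0 < T) (FC : continuous_on_chi T F) (phiC : C12 T phi).
Hypothesis hC : forall c, atlas c -> C2on (cran c) (h \o cinv c).
Hypotheses (It : `[0, T]%classic t) (ac : atlas c) (cx : cdom c x).

(** A parameter [q] is [(s, z, m, e)]: time, point of the chart, shift of the value, factor of the
    bump. [J q] collects the resulting arguments of [F] in the chart [c], and [q0] is the
    unperturbed parameter. *)
Let A := [set q : R * 'rV[R]_n * R * R | `[0, T]%classic q.1.1.1 /\ cran c q.1.1.2].
Let q0 : R * 'rV[R]_n * R * R := (t, cfun c x, 0, 0).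
Let N := within A (nbhs q0).

Let gradJ (q : R * 'rV[R]_n * R * R) : 'cV[R]_n :=
  gradient_in c (phi q.1.1.1) q.1.1.2 + q.2 *: gradient_in c h q.1.1.2.
Let hessJ (q : R * 'rV[R]_n * R * R) : 'M[R]_n :=
  hessian_in c (phi q.1.1.1) q.1.1.2 + q.2 *: hessian_in c h q.1.1.2.
Let J q := (q.1.1.1, q.1.1.2, phi q.1.1.1 (cinv c q.1.1.2) + q.1.2, gradJ q, hessJ q).

Let cts11 : {for q0, continuous (fun q : R * 'rV[R]_n * R * R => q.1.1)}.
Proof. by apply: (@continuous_comp _ _ _ fst fst); exact: cvg_fst. Qed.

Let cts_s : {for q0, continuous (fun q : R * 'rV[R]_n * R * R => q.1.1.1)}.
Proof. by apply: (@continuous_comp _ _ _ _ fst _ cts11); exact: cvg_fst. Qed.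

Let cts_z : {for q0, continuous (fun q : R * 'rV[R]_n * R * R => q.1.1.2)}.
Proof. by apply: (@continuous_comp _ _ _ _ snd _ cts11); exact: cvg_snd. Qed.

Let cvg_s : q.1.1.1 @[q --> N] --> t.
Proof. by apply: cvg_within_filter; exact: cts_s. Qed.

Let cvg_m : q.1.2 @[q --> N] --> (0 : R).
Proof.
apply: cvg_within_filter.
have H : {for q0, continuous (fun q : R * 'rV[R]_n * R * R => q.1.2)}.
  by apply: (@continuous_comp _ _ _ fst snd); [exact: cvg_fst|exact: cvg_snd].
exact: H.
Qed.

Let base : q.1.1 @[q --> N] --> within (`[0, T] `*` cran c) (nbhs (t, cfun c x)).
Proof.
move=> P PH.
have : \forall q \near within (`[0, T] `*` cran c) (nbhs (t, cfun c x)), P q by exact: PH.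
rewrite near_withinE => PN.
suff : \forall q \near N, P q.1.1 by [].
rewrite near_withinE.
have HP : \forall q \near q0, (`[0, T] `*` cran c) q.1.1 -> P q.1.1 by exact: (cts11 PN).
by apply: filterS HP => -[[[s z] m] e] /= Pq [Iq cq]; apply: Pq.
Qed.

Let cvg_within_base (W : topologicalType) (G : R * 'rV[R]_n -> W) :
  {within `[0, T] `*` cran c, continuous G} -> G q.1.1 @[q --> N] --> G (t, cfun c x).
Proof.
move=> cG; apply: (cvg_comp _ _ base).
exact: (within_cvg cG (conj It (cran_cfun cx) : (`[0, T] `*` cran c) (t, cfun c x))).
Qed.

Let cvg_space (W : topologicalType) (g : 'rV[R]_n -> W) :
  {for cfun c x, continuous g} -> g q.1.1.2 @[q --> N] --> g (cfun c x).
Proof.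
move=> cg; apply: cvg_within_filter.
exact: (@continuous_comp _ _ _ _ g _ cts_z cg).
Qed.

Let cvg_e : q.2 @[q --> N] --> (0 : R).
Proof. by apply: cvg_within_filter; exact: cvg_snd. Qed.

Let cvg_grad : gradJ q @[q --> N] --> gradJ q0.
Proof.
have [_ _ p1 _] := phiC ac.
apply: cvgD.
  apply: cvg_mx => i j; under eq_fun do rewrite mxE; rewrite mxE.
  by have [_ /cvg_within_base] := p1 i.
apply: cvgZ cvg_e _; apply: (@cvg_space _ (gradient_in c h)).
apply: (@cvg_mx _ _ (nbhs (cfun c x))) => i j; under eq_fun do rewrite mxE; rewrite mxE.
exact: C1on_cts_partial (hC ac).1 (cran_cfun cx).
Qed.

Let cvg_hess : hessJ q @[q --> N] --> hessJ q0.
Proof.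
have [_ _ p1 p2] := phiC ac.
apply: cvgD.
  apply: cvg_mx => i j; under eq_fun do rewrite mxE; rewrite mxE.
  apply: cvgB; first by have [_ /cvg_within_base] := p2 i j.
  apply: cvg_sum => k; apply: cvgM.
    apply: (@cvg_space _ (fun z => christoffel c z k i j)).
    exact: christoffel_continuous ac (cran_cfun cx).
  by have [_ /cvg_within_base] := p1 k.
apply: cvgZ cvg_e _; apply: (@cvg_space _ (hessian_in c h)).
apply: (@cvg_mx _ _ (nbhs (cfun c x))) => i j; under eq_fun do rewrite mxE; rewrite mxE.
apply: (@cvgB _ _ _ (nbhs (cfun c x))).
  exact: C1on_cts_partial ((hC ac).2 j) (cran_cfun cx).
apply: (@cvg_sum _ _ (nbhs (cfun c x))) => k; apply: (@cvgM _ _ (nbhs (cfun c x))).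
  exact: christoffel_continuous ac (cran_cfun cx).
exact: C1on_cts_partial (hC ac).1 (cran_cfun cx).
Qed.

Let J_chi q : A q -> chi_in T c (J q).
Proof.
move=> [Iq cq]; split=> //; rewrite /hessJ.
have := hessian_in_sym (C12_slice phiC ac Iq) cq.
have := hessian_in_sym (hC ac) cq.
move: (hessian_in _ _ _) (hessian_in _ _ _) => B C Bs Cs.
by rewrite linearD linearZ /= Bs Cs.
Qed.

Let A0 : A q0. Proof. by split => //; exact: cran_cfun. Qed.

Let cvg_J : J q @[q --> N] --> within (chi_in T c) (nbhs (J q0)).
Proof.
have H : J q @[q --> N] --> J q0.
  have [p0 _ _ _] := phiC ac.
  have hz : q.1.1.2 @[q --> N] --> cfun c x by exact: (@cvg_space _ id).
  have hr : phi q.1.1.1 (cinv c q.1.1.2) + q.1.2 @[q --> N] -->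
      phi t (cinv c (cfun c x)) + 0 by exact: cvgD (cvg_within_base p0) cvg_m.
  exact: (cvg_pair (cvg_pair (cvg_pair (cvg_pair cvg_s hz) hr) cvg_grad) cvg_hess).
move=> P PH.
have : \forall p \near within (chi_in T c) (nbhs (J q0)), P p by exact: PH.
rewrite near_withinE => PN.
suff : \forall q \near N, P (J q) by [].
have h1 : \forall q \near N, A q by rewrite near_withinE; exact: nearW.
have h2 : \forall q \near N, chi_in T c (J q) -> P (J q) by exact: (H _ PN).
by apply: filterS2 h1 h2 => q /J_chi chiq; apply.
Qed.

Let G (q : R * 'rV[R]_n * R * 'cV[R]_n * 'M[R]_n) : R :=
  let: (t, y, r, z, A) := q in
  let x := cinv c y in @F t x r (cotangent_of c x z) (bilinear_form_of c x A).

Let dtphi (p : R * 'rV[R]_n) := deriv_within `[0, T] (fun s => phi s (cinv c p.2)) p.1.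

(** Positivity at [q0] persists near [q0] by continuity. The term [2 * (s - t)] is the time
    derivative of the penalty [(s - t) ^+ 2]; the shift [m] is independent of [e] because the
    touching value is known only through an estimate. *)
Lemma jet_positive :
  0 < time_derivative T phi t x +
    @F t x (phi t x) (differential (phi t) x) (hessian (phi t) x) ->
  exists2 d, 0 < d & forall s x' m e, `[0, T]%classic s -> cdom c x' ->
    `|s - t| < d -> `|cfun c x' - cfun c x| < d -> `|m| < d -> `|e| < d ->
    0 < time_derivative T phi s x' + 2 * (s - t) + @F s x' (phi s x' + m)
      (cotangent_of c x'
        (gradient_in c (phi s) (cfun c x') + e *: gradient_in c h (cfun c x')))
      (bilinear_form_of c x'
        (hessian_in c (phi s) (cfun c x') + e *: hessian_in c h (cfun c x'))).
Proof.
rewrite (differential_of ac cx (C12_slice phiC ac It).1).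
rewrite (hessian_of ac cx (C12_slice phiC ac It)) => pos.
have [_ [_ pt] _ _] := phiC ac.
have GJ : G (J q) @[q --> N] --> G (J q0).
  by apply: (cvg_comp _ _ cvg_J); exact: (within_cvg (FC ac) (J_chi A0)).
have H : dtphi q.1.1 + 2 * (q.1.1.1 - t) + G (J q) @[q --> N] --> 
    dtphi (t, cfun c x) + 2 * (t - t) + G (J q0).
  apply: cvgD GJ; apply: cvgD; first exact: (cvg_within_base pt).
  apply: cvgMl_tmp; apply: cvgB; last exact: cvg_cst.
  exact: cvg_s.
have pos0 : 0 < dtphi (t, cfun c x) + 2 * (t - t) + G (J q0).
  rewrite subrr mulr0 addr0 /dtphi /G /J /gradJ /hessJ /= addr0 !scale0r !addr0.
  by rewrite cfunK.
have : \forall q \near N, 0 < dtphi q.1.1 + 2 * (q.1.1.1 - t) + G (J q).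
  exact: (H _ (lt_nbhsr pos0)).
rewrite near_withinE => /nbhs_ballP[d /= d0 dP].
exists d; first exact: d0.
move=> s x' m e Is cx' sd xd md ed.
have bq : ball q0 d (s, cfun c x', m, e).
  split; last by rewrite -ball_normE /= sub0r normrN.
  split; last by rewrite -ball_normE /= sub0r normrN.
  by split; rewrite -ball_normE /= distrC.
have := dP _ bq (conj Is (cran_cfun cx')).
rewrite /dtphi /G /J /gradJ /hessJ /= (cfunK cx').
exact: id.
Qed.

End JetContinuity.

Lemma near_cfun (R : realType) n (X : topologicalType) (c : chart R n X) x (d : R) :
  cdom c x -> 0 < d -> \forall y \near x, `|cfun c y - cfun c x| < d.
Proof.
move=> cx d0.
have nb : nbhs (cfun c x) [set z | `|z - cfun c x| < d].
  apply/nbhs_ballP; exists d => //= z.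
  by rewrite -ball_normE /= distrC.
exact: (continuous_cfun cx nb).
Qed.

(** * The perturbation argument *)

Section Main.
Context {R : realType} {n : nat} {M : riemannianManifold R n}.

Section TestFunction.
Variables (T : R) (phi : R -> M -> R) (h : M -> R) (t k e : R).
Hypotheses (T0 : 0 < T) (phiC : C12 T phi).
Hypothesis hC : forall c, atlas c -> C2on (cran c) (h \o cinv c).

(** Used with [e] negative. The constant [k] carries the value of the bump at [x] and, in a second
    use, also the level of the maximum. *)
Definition perturbed (s : R) (y : M) : R := phi s y + (((s - t) ^+ 2 + k) + e * h y).

Let da (s : R) : is_derive s 1 (fun s : R => (s - t) ^+ 2 + k) (2 * (s - t)).
Proof.
have d1 : is_derive s 1 (fun s : R => s - t) (1 : R).
  have [d1 d2] := is_deriveB (is_derive_id s (1 : R)) (is_derive_cst t s (1 : R)).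
  by split; [exact: d1|rewrite [LHS]d2 subr0].
have [d2 d3] := is_deriveD (is_deriveM d1 d1) (is_derive_cst k s (1 : R)).
split.
  by rewrite (_ : (fun s => _) = (fun s => s - t) * (fun s => s - t) + cst k) //.
rewrite (_ : (fun s => _) = (fun s => s - t) * (fun s => s - t) + cst k) //.
rewrite d3 addr0 /GRing.scale /=; ring.
Qed.

Let cda : continuous (fun s : R => 2 * (s - t)).
Proof.
move=> s; apply: cvgMl_tmp; apply: cvgB; [exact: cvg_id|exact: cvg_cst].
Qed.

Let aC : C12 T (fun s (_ : M) => (s - t) ^+ 2 + k).
Proof. exact: (C12_time T0 da cda). Qed.

Let ehC : C12 T (fun _ (y : M) => e * h y).
Proof.
by apply: (C12_space T0) => c ac; exact: (C2onZ e (open_cran c) (hC ac)).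
Qed.

Let aehC : C12 T (fun s (y : M) => ((s - t) ^+ 2 + k) + e * h y).
Proof. exact: (C12D T0 aC ehC). Qed.

Lemma perturbed_C12 : C12 T perturbed.
Proof. exact: (C12D T0 phiC aehC). Qed.

Lemma perturbed_time_derivative s y : `[0, T]%classic s ->
  time_derivative T perturbed s y = time_derivative T phi s y + 2 * (s - t).
Proof.
move=> Is; rewrite (time_derivativeD T0 y phiC aehC Is) (time_derivativeD T0 y aC ehC Is).
congr (_ + _); rewrite -[RHS]addr0; congr (_ + _); apply: (deriv_withinE T0 Is).
  have [d1 <-] := da s; apply: quotients_within_differentiable.
  exact/derivable1_diffP.
rewrite /quotients_within (_ : (fun u => _) = fun _ => 0); first exact: cvg_cst.
by apply/funext => u; rewrite subrr scaler0.
Qed.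

End TestFunction.
End Main.

Definition sup_family (R : realType) (n : nat) (M : riemannianManifold R n)
    (FF : set (R -> M -> \bar R)) (t : R) (x : M) : \bar R :=
  ereal_sup [set u t x | u in FF].

Lemma solution_le_envelope (R : realType) (n : nat) (M : riemannianManifold R n)
    (Omega : set M) (T : R) (FF : set (R -> M -> \bar R)) u s y :
  FF u -> domain T Omega (s, y) ->
  (u s y <= usc_envelope T Omega (sup_family FF) s y)%E.
Proof.
move=> Fu D; apply: le_trans (usc_envelope_ge _ D).
by apply: ereal_sup_ubound; exists u.
Qed.

Lemma envelope_superjet (R : realType) (n : nat) (M : riemannianManifold R n)
    (Omega : set M) (T : R)
    (F : R -> forall x : M, R -> cotangent x -> bilinear_form x -> R)
    (FF : set (R -> M -> \bar R)) (env := usc_envelope T Omega (sup_family FF))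
    (t : R) (x : M) (p : R) (z : cotangent x) (A : bilinear_form x) :
  locally_compact_subset Omega -> 0 < T -> continuous_on_chi T F ->
  (forall u, FF u -> viscosity_solution T Omega F u) ->
  domain T Omega (t, x) -> env t x \is a fin_num ->
  @superjet _ _ _ T Omega env t x (p, z, A) ->
  p + F t x (fine (env t x)) z A <= 0.
Proof.
move=> lcO T0 FC solF.
move=> Dtx efin [phi [phiC phi0 near_phi] [<- <- <-]] {p z A}.
have [/= It Ox] := Dtx; move: It; rewrite in_itv /= => /andP[t0 tT].
have It : `[0, T]%classic t by rewrite /= in_itv /= !ltW.
have envE : fine (env t x) = phi t x.
  by move: phi0; rewrite -{1}(fineK efin) -EFinB => -[/eqP]; rewrite subr_eq0 => /eqP.
rewrite envE leNgt; apply/negP => pos.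
have [ac cx] : atlas (chart_at x) /\ cdom (chart_at x) x.
  by split; [exact: chart_at_atlas|exact: chart_at_dom].
set c := chart_at x in ac cx.
have [r r0 rc] := chart_cball cx.
pose h := bump c x r.
have hC (c' : chart R n M) (ac' : atlas c') := bump_C2 ac r0 rc ac'.
have [d d0 dP] := jet_positive FC phiC hC It ac cx pos.
move: near_phi; rewrite near_withinE => -[[P1 P2] /= [P1t P2x] P12].
have [K0 [cK0 K0O K0x]] := lcO x Ox.
(* [W] gathers the spatial conditions: [phi] stays above the envelope, points of [Omega] lie in the
   compact [K0], and the chart coordinates are within [d] of those of [x]. *)
pose W := [set y | [/\ P2 y, Omega y -> K0 y, cdom c y & `|cfun c y - cfun c x| < d]].
have Wx : nbhs x W.
  have n1 : nbhs x [set y | Omega y -> K0 y] by exact: K0x.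
  have n2 := near_cfun cx d0; have n3 := nbhs_cdom cx.
  by near=> y; split; near: y.
have [r1 r10 r1P] : exists2 r1, 0 < r1 & forall z, `|z - cfun c x| <= r1 ->
    cran c z /\ W (cinv c z).
  have : \forall z \near cfun c x, cran c z /\ W (cinv c z).
    have n1 := nbhs_cran (cran_cfun cx).
    have Wx' : nbhs (cinv c (cfun c x)) W by rewrite cfunK.
    have n2 := continuous_cinv (cran_cfun cx) Wx'.
    by apply: filterS2 n1 n2.
  move=> /nbhs_ballP[r' /= r'0 r'P]; exists (r' / 2); first exact: divr_gt0.
  move=> z zr; apply: r'P; rewrite -ball_normE /= distrC.
  by apply: le_lt_trans zr _; clear -r'0; lra.
pose Kc := cinv c @` [set z | `|z - cfun c x| <= r1].
have cKc : compact Kc.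
  by apply: compact_cinv_image; [exact: compact_cball|move=> z /r1P[]].
have clKc : closed Kc by apply: compact_closed cKc; exact: manifold_hausdorff.
(* [U] is an open chart ball inside the compact [Kc]. A maximum over [Kc] located in [U] is a local
   one, and the bump will force it there. *)
pose U := [set y | cdom c y /\ `|cfun c y - cfun c x| < r1].
have oU y : U y -> nbhs y U.
  move=> [cy yr]; have n1 := nbhs_cdom cy.
  have r1y : 0 < r1 - `|cfun c y - cfun c x| by rewrite subr_gt0.
  apply: filterS2 n1 (near_cfun cy r1y) => y' cy' yy'; split => //.
  have := ler_normD (cfun c y' - cfun c y) (cfun c y - cfun c x).
  by move: yy'; rewrite subrKA; clear; lra.
have Ux : nbhs x U by apply: oU; split => //; rewrite subrr normr0.
have UKc y : U y -> Kc y.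
  by move=> [cy yr]; exists (cfun c y); [exact: ltW|exact: cfunK].
have KcW y : Kc y -> W y by move=> [z /r1P[_ Wz] <-].
have [e0 e00 hU] := bump_strict_max cx r0 Ux.
have [rho rho0 rhoP] : exists2 rho, 0 < rho & forall s, `|s - t| < rho -> P1 s.
  have /nbhs_ballP[rho /= rho0 rhoP] := P1t; exists rho => // s st.
  by apply: rhoP; rewrite -ball_normE /= distrC.
(* The halves give strict inequalities on the closed time interval: the touching condition holds
   there, it stays inside []0, T[], and times are within [d] of [t]. *)
pose de := Num.min (rho / 2) (Num.min (t / 2) (Num.min ((T - t) / 2) (d / 2))).
have de0 : 0 < de by rewrite !lt_min !divr_gt0 //= subr_gt0.
have [de1 de2 de3 de4] : [/\ de < rho, de < t, de < T - t & de < d].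
  have : de <= de by [].
  rewrite {2}/de !le_min => /and4P[]; have : 0 < T - t by rewrite subr_gt0.
  by move: (de) d0 rho0 t0; clear; move=> D *; split; lra.
pose ep := d / 2; have ep0 : 0 < ep by rewrite divr_gt0.
(* [eta] is at most the space penalty outside [U], the time penalty at distance [de], and the
   allowed shift [d] of the value. *)
pose eta := Num.min (ep * e0) (Num.min (de ^+ 2) d).
have eta0 : 0 < eta by rewrite !lt_min mulr_gt0 //= exprn_gt0.
have [eta1 eta2 eta3] : [/\ eta <= ep * e0, eta <= de ^+ 2 & eta <= d].
  by apply/and3P; have : eta <= eta by []; rewrite {2}/eta !le_min.
pose psi0 := perturbed phi h t (ep * h x) (- ep).
have psi0C : C12 T psi0 by exact: perturbed_C12.
have psi0tx : psi0 t x = phi t x.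
  by rewrite /psi0 /perturbed subrr expr0n /=; ring.
have [[Q1 Q2] /= [Q1t Q2x] Q12] : \forall q \near (t, x),
    (`[0, T] `*` setT) q -> psi0 q.1 q.2 < phi t x + eta / 2.
  have := C12_continuous psi0C It (lt_nbhsl (_ : psi0 t x < phi t x + eta / 2)).
  rewrite psi0tx ltrDl divr_gt0 // => /(_ isT) H.
  have : \forall q \near within (`[0, T] `*` setT) (nbhs (t, x)),
    psi0 q.1 q.2 < phi t x + eta / 2 by exact: H.
  by rewrite near_withinE.
have /nbhs_ballP[d1 /= d10 d1P] := Q1t.
have [r2 r20 r2P] := rdist_nbhs (filterI Q2x Ux).
pose r3 := Num.min (d1 / 2) (Num.min de r2).
have r30 : 0 < r3 by rewrite lt_min divr_gt0 //= lt_min de0.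
have [r31 r32 r33] : [/\ r3 < d1, r3 <= de & r3 <= r2].
  have : r3 <= r3 by []; rewrite {2}/r3 le_min le_min => /and3P[r3d1 *].
  by split => //; move: r3d1 d10; clear; lra.
(* Half of [eta] is spent on approximating the envelope by [u], half on the variation of [psi0] near
   [(t, x)]; together they give [g > - eta] at [(s2, y2)]. *)
have : ((phi t x - eta / 2)%:E < env t x)%E.
  by rewrite -(fineK efin) envE lte_fin ltrBlDr ltrDl divr_gt0.
move=> /usc_envelope_gt/(_ r30)[[s2 y2] /= [D2 st2 xy2]].
move=> /ereal_sup_gt[_ [u Fu <-] u2].
have [ufin uusc uvisc] := solF u Fu.
(* [K0] keeps the points in [Omega], [Kc] keeps them in the chart ball; their intersection is
   compact as [Kc] is closed. *)
pose Cc := K0 `&` Kc.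
pose K := `[t - de, t + de] `*` Cc.
have cK : compact K.
  by apply: compact_setX; [exact: segment_compact|exact: compact_closedI].
have IK s : `[t - de, t + de]%classic s <-> `|s - t| <= de.
  by rewrite /= in_itv /= ler_distl.
have IT s : `|s - t| <= de -> 0 < s < T.
  rewrite ler_distl => /andP[]; move: (de) de2 de3; clear => D *.
  by apply/andP; split; lra.
have KD q : K q -> domain T Omega q.
  case: q => s y [/= Is [K0y _]]; split => /=; last exact: K0O.
  by rewrite in_itv /=; apply: IT; apply/IK.
have ITc s : `|s - t| <= de -> `[0, T]%classic s.
  by move=> /IT/andP[? ?]; rewrite /= in_itv /= !ltW.
have inCc y : Omega y -> U y -> Cc y.
  by move=> Oy /UKc Ky; split => //; have [_ + _ _] := KcW _ Ky; apply.
have [/= _ O2] := D2.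
have [Q2y2 U2] : Q2 y2 /\ U y2.
  by apply: r2P; apply: le_trans xy2 _; rewrite lee_fin.
have st2' : `|s2 - t| <= de by exact: le_trans st2 r32.
have K2 : K (s2, y2) by split; [exact/IK|exact: inCc].
pose g (q : R * M) := fine (u q.1 q.2) - psi0 q.1 q.2.
have g2 : - eta < g (s2, y2).
  have p2 : psi0 s2 y2 < phi t x + eta / 2.
    apply: (Q12 (s2, y2)); split => //=; last exact: ITc.
    by apply: d1P; rewrite -ball_normE /= distrC (le_lt_trans st2).
  move: u2 p2; rewrite -(fineK (ufin _ _ D2)) lte_fin /g /=.
  by move: (psi0 s2 y2) (fine _); clear => *; lra.
have gusc q : K q -> forall a, g q < a -> \forall q' \near within K (nbhs q), g q' < a.
  case: q => s y Kq a; rewrite /g /= => ga.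
  have Dq := KD _ Kq.
  (* [b] is the midpoint of [u] and [a + psi0]: the strict gap is shared between the semicontinuity
     of [u] and the continuity of [psi0]. *)
  pose b := (fine (u s y) + a + psi0 s y) / 2.
  have ub : (u s y < b%:E)%E.
    rewrite -(fineK (ufin _ _ Dq)) lte_fin /b.
    by move: (psi0 s y) (fine _) ga; clear => *; lra.
  have pb : b - a < psi0 s y.
    by rewrite /b; move: (psi0 s y) (fine _) ga; clear => *; lra.
  have Is : `[0, T]%classic s by have [/IK/ITc] := Kq.
  have n1 := uusc s y Dq b ub.
  have n2 : \forall q' \near within (`[0, T] `*` setT) (nbhs (s, y)),
    b - a < psi0 q'.1 q'.2 by exact: (C12_continuous psi0C Is (lt_nbhsr pb)).
  move: n1 n2; rewrite !near_withinE; apply: filterS2 => -[s' y'] /= h1 h2 K'.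
  have D' := KD _ K'.
  have {}h1 := h1 D'; rewrite -(fineK (ufin _ _ D')) lte_fin in h1.
  have {}h2 : b - a < psi0 s' y' by apply: h2; split => //; have [/IK/ITc] := K'.
  by move: (psi0 s' y') (fine (u s' y')) (b) h1 h2; clear => *; lra.
have [[s1 y1] K1 gmax] := usc_compact_max cK (ex_intro _ _ K2) gusc.
have D1 := KD _ K1; have [/= I1 [K01 Kc1]] := K1.
have st1 : `|s1 - t| <= de by apply/IK.
have W1 := KcW _ Kc1; have [P2y1 _ cy1 y1d] := W1.
have u1fin := ufin _ _ D1.
pose m0 := g (s1, y1).
have m0eta : - eta < m0 by apply: lt_le_trans g2 _; exact: gmax.
(* [A] and [B] are the penalties paid at the maximum. Since [u <= env <= phi] there,
   [m0 <= - (A + B)], and [- eta < m0] leaves both too small for the edge of [K]. *)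
pose A := (s1 - t) ^+ 2; pose B := ep * (h x - h y1).
have A0 : 0 <= A by exact: sqr_ge0.
have B0 : 0 <= B by rewrite mulr_ge0 ?subr_ge0 ?(ltW ep0) //; exact: bump_le.
have m0AB : m0 <= - (A + B).
  have le1 : fine (u s1 y1) <= phi s1 y1.
    have le_env : (env s1 y1 - (phi s1 y1)%:E <= 0)%E.
      exact: (P12 (s1, y1) (conj (rhoP _ (le_lt_trans st1 de1)) P2y1) D1).
    rewrite sube_le0 in le_env.
    have := le_trans (solution_le_envelope Fu D1) le_env.
    by rewrite -(fineK u1fin) lee_fin.
  rewrite /m0 /g /= /psi0 /perturbed -/A /B.
  by move: (fine _) (phi _ _) (h _) (h _) (A) le1; clear => *; lra.
have AB_eta : A + B < eta.
  by move: (A) (B) (m0) (eta) m0eta m0AB; clear => *; lra.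
have s1t : `|s1 - t| < de.
  rewrite ltNge; apply/negP => H.
  have AE : A = `|s1 - t| ^+ 2 by rewrite real_normK ?num_real.
  have : de ^+ 2 <= A by rewrite AE; apply: lerXn2r H; rewrite nnegrE // ltW.
  by move: (A) (B) (de ^+ 2) (eta) B0 eta2 AB_eta; clear => *; lra.
have U1 : U y1.
  apply: contrapT => nU; have := hU _ nU; rewrite -/h => H.
  have : ep * e0 <= B by rewrite /B ler_wpM2l ?(ltW ep0) // lerBrDl -lerBrDr.
  by move: (A) (B) (ep * e0) (eta) A0 eta1 AB_eta; clear => *; lra.
(* Adding the level [m0] to [psi0] makes [u - psi] vanish at its maximum, as the superjet
   requires. *)
pose k := ep * h x + m0.
pose psi := perturbed phi h t k (- ep).
pose m := (A + k) + (- ep) * h y1.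
have um : fine (u s1 y1) = phi s1 y1 + m.
  by rewrite /m /k /m0 /g /= /psi0 /perturbed -/A; ring.
(* The shift equals [A + B + m0], which lies between [- eta] and 0. *)
have md : `|m| < d.
  have -> : m = A + B + m0 by rewrite /m /k /B; ring.
  move: (A) (B) (m0) (eta) A0 B0 m0AB m0eta eta3; clear => *.
  by rewrite ltr_norml; apply/andP; split; lra.
have jet : @superjet _ _ _ T Omega u s1 y1
    (time_derivative T psi s1 y1, differential (psi s1) y1, hessian (psi s1) y1).
  exists psi; last by [].
  split; first exact: perturbed_C12.
    by rewrite -(fineK u1fin) -EFinB um subrr.
  rewrite near_withinE.
  exists ([set s | `|s - t| < de], U) => /=.
    split; last exact: oU.
    apply/nbhs_ballP; exists (de - `|s1 - t|); first by rewrite /= subr_gt0.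
    move=> s; rewrite -ball_normE /= => ss1.
    have := ler_normD (s - s1) (s1 - t); rewrite subrKA.
    by rewrite distrC in ss1; move: (de) ss1; clear => *; lra.
  move=> [s y] /= [sde Uy] Dq; have [/= _ Oy] := Dq.
  have Kq : K (s, y) by split; [apply/IK; exact: ltW|exact: inCc].
  have := gmax _ Kq; rewrite -/m0 /g /= => gm.
  rewrite -(fineK (ufin _ _ Dq)) -EFinB lee_fin.
  move: gm; rewrite /psi /psi0 /perturbed /k.
  by move: (m0) (fine _) (phi _ _) (h _) (h _); clear => *; lra.
have := uvisc s1 y1 D1 _ _ _ jet.
have Is1 := ITc _ st1.
have phiC2 := C12_slice phiC ac Is1.
have psiC2 : C2on (cran c) (psi s1 \o cinv c).
  exact: (perturbed_C2 (A + k) (- ep) phiC2 (hC _ ac)).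
have cz1 := cran_cfun cy1.
rewrite (perturbed_time_derivative t k (- ep) T0 phiC hC _ Is1).
rewrite (differential_of ac cy1 psiC2.1) (hessian_of ac cy1 psiC2).
rewrite (gradient_in_perturbed (A + k) (- ep) phiC2 (hC _ ac) cz1).
rewrite (hessian_in_perturbed (A + k) (- ep) phiC2 (hC _ ac) cz1) um.
apply/negP; rewrite -ltNge; apply: dP => //.
- exact: lt_trans s1t de4.
- by rewrite normrN gtr0_norm // /ep; move: d0; clear; lra.
Unshelve. all: by end_near. Qed.

Unset Implicit Arguments.

Theorem lemma4p3 (R : realType) (n : nat) (M : riemannianManifold R n)
  (Omega : set M) (T : R)
  (F : R -> forall x : M, R -> cotangent x -> bilinear_form x -> R)
  (FF : set (R -> M -> \bar R)) :
  locally_compact_subset Omega ->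
  0 < T ->
  continuous_on_chi T F ->
  FF !=set0 ->
  (forall u, FF u -> viscosity_solution T Omega F u) ->
  let w := fun t x => ereal_sup [set u t x | u in FF] in
  (forall t x, domain T Omega (t, x) ->
     (usc_envelope T Omega w t x < +oo)%E) ->
  viscosity_solution T Omega F (usc_envelope T Omega w).
Proof.
move=> lcO T0 FC [u Fu] solF w wfin.
have env_fin t x : domain T Omega (t, x) -> usc_envelope T Omega w t x \is a fin_num.
  move=> D; rewrite fin_numE; apply/andP; split; last by rewrite lt_eqF // wfin.
  (* A single member of the family is real-valued and below the envelope, which excludes [-oo]. *)
  rewrite gt_eqF //; apply: lt_le_trans (solution_le_envelope Fu D).
  by have [ufin _ _] := solF u Fu; rewrite ltNye_eq ufin.
split => //; first exact: usc_envelope_usc.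
move=> t x D p z A; exact: envelope_superjet lcO T0 FC solF D (env_fin t x D).
Qed.
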